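(* The category $\mathcal{C}(nupOp)^{op}$ described in the context is quasi-Gröbner.
   Context: Quasi-Gröbner categories. Let $\mathcal{C}$ be a small category and $c$ an object. An admissible order on the morphisms out of $c$ is a choice, for every object $c'$, of a well-order $\preceq_{c'}$ on $\mathrm{Hom}(c,c')$ such that for all $f,f':c\to c'$ and $g:c'\to c''$, $f\prec_{c'} f'$ implies $g\circ f\prec_{c''} g\circ f'$. On the set of morphisms out of $c$ put the preorder $f\le g$ iff $g=h\circ f$ for some $h$; $|c/\mathcal{C}|$ is the associated poset. A poset is Noetherian if every sequence $x_1,x_2,\dots$ has $i<j$ with $x_i\le x_j$. $\mathcal{C}$ is Gröbner if for every object $c$: (G1) the morphisms out of $c$ admit an admissible order, and (G2) $|c/\mathcal{C}|$ is Noetherian. A functor $\Phi:\mathcal{C}\to\mathcal{D}$ has property (F) if for every object $d$ of $\mathcal{D}$ there are finitely many objects $c_1,\dots,c_n$ of $\mathcal{C}$ and morphisms $f_i:d\to\Phi(c_i)$ such that every morphism $f:d\to\Phi(c)$ factors as $\Phi(g)\circ f_i$ for some $i$ and some $g:c_i\to c$. A category $\mathcal{D}$ is quasi-Gröbner if there is a Gröbner category $\mathcal{C}$ and an essentially surjective functor $\mathcal{C}\to\mathcal{D}$ with property (F). Operadic graphs. A graph with half-edges is a finite set $V$ of vertices, a finite set $H$ of half-edges, an involution $inv$ on $H$ and a map $t:H\to V$; fixed points of $inv$ are leaves, two-element orbits are edges. An operadic graph is such a graph together with a total order on the leaves (indexed $0,1,\dots$), for each vertex $v$ a total order on $t^{-1}(v)$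 (indexed $0,1,\dots$), and a total order on $V$ (indexed $1,\dots,n$). Operadic graphs are considered up to isomorphism preserving all this data. An operadic tree is an operadic graph whose underlying graph is a tree, having at least one leaf, such that at every vertex the $0$-th half-edge is the one on the path towards the $0$-th leaf (the root); it is planar if the order on its non-root leaves is the planar order induced by the orders of half-edges at the vertices. The arity of a vertex is its number of non-$0$-th half-edges (vertices of arity $0$ are allowed). The category $\mathcal{C}(nupOp)^{op}$: objects are planar operadic trees with at least one vertex. If $p$ has vertices $v_1<\dots<v_n$, a morphism $f:p\to q$ consists of planar operadic trees $q_1,\dots,q_n$ (each with at least one vertex), where $q_l$ has exactly as many leaves as $v_l$ has half-edges, together with a bijection from $\bigsqcup_l V(q_l)$ to the vertex set of $q$ that is order preserving on each $V(q_l)$, such that $q$ is the graph obtained by substitution: take the disjoint union of the $q_l$, identify the $i$-th leaf of $q_l$ with the $i$-th half-edge of $v_l$; if the $i$-th half-edge of $v_j$ and the $k$-th half-edge of $v_l$ form an edge of $p$, then the $i$-th leaf of $q_j$ and the $k$-th leaf of $q_l$ form an edge of $q$; if the $i$-th half-edge of $v_j$ is the $k$-th leaf of $p$, then the $i$-th leaf of $q_j$ is the $k$-th leaf of $q$; half-edge orders at vertices come from the $q_l$, and the vertex order of $q$ is transported along the bijection. Composition is iterated substitution. (This is the opposite of the category $\mathcal{C}(P)$ of de Brito et al.\ for the operad $P$ of planar operads, restricted to operations of non-zero arity.) *)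

(* Defs.v *)
From mathcomp Require Import all_boot.
Set Implicit Arguments.
Unset Strict Implicit.
Unset Printing Implicit Defensive.

Record Category := {
  Ob :> Type;
  Hom : Ob -> Ob -> Type;
  idm : forall a, Hom a a;
  comp : forall a b c, Hom b c -> Hom a b -> Hom a c;
  comp_assoc : forall a b c d (h : Hom c d) (g : Hom b c) (f : Hom a b),
      comp h (comp g f) = comp (comp h g) f;
  comp_idl : forall a b (f : Hom a b), comp (idm b) f = f;
  comp_idr : forall a b (f : Hom a b), comp f (idm a) = f
}.
Arguments Hom {C} a b : rename.
Arguments idm {C} a : rename.
Arguments comp {C a b c} g f : rename.

Definition well_order (T : Type) (le : T -> T -> Prop) : Prop :=
  [/\ (forall x, le x x),
      (forall x y, le x y -> le y x -> x = y),
      (forall x y z, le x y -> le y z -> le x z),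
      (forall x y, le x y \/ le y x)
    & (forall P : T -> Prop, (exists x, P x) ->
         exists m, P m /\ forall y, P y -> le m y)].

Definition strict (T : Type) (le : T -> T -> Prop) (x y : T) : Prop :=
  le x y /\ x <> y.

Definition admissible_order (C : Category) (c : C)
    (le : forall c' : C, Hom c c' -> Hom c c' -> Prop) : Prop :=
  (forall c' : C, well_order (le c')) /\
  (forall (c' c'' : C) (f f' : Hom c c') (g : Hom c' c''),
      strict (le c') f f' -> strict (le c'') (comp g f) (comp g f')).

Definition under_noetherian (C : Category) (c : C) : Prop :=
  forall s : nat -> {c' : C & Hom c c'},
    exists i j, i < j /\
      exists h : Hom (projT1 (s i)) (projT1 (s j)),
        projT2 (s j) = comp h (projT2 (s i)).

Definition Groebner (C : Category) : Prop :=
  forall c : C,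
    (exists le, @admissible_order C c le) /\ under_noetherian c.

(* Categories whose composition and identities are given as (graph)   *)
(* relations: used for the target category C(nupOp)^op, whose         *)
(* composition "iterated substitution" is specified relationally.      *)

Record RelCategory := {
  ROb :> Type;
  RHom : ROb -> ROb -> Type;
  RIsComp : forall a b c, RHom b c -> RHom a b -> RHom a c -> Prop;
  RIsId : forall a, RHom a a -> Prop
}.
Arguments RHom {D} a b : rename.
Arguments RIsComp {D a b c} g f h : rename.
Arguments RIsId {D a} h : rename.

Record Functor (C : Category) (D : RelCategory) := {
  Fob :> C -> D;
  Fhom : forall a b : C, Hom a b -> RHom (Fob a) (Fob b);
  Fhom_id : forall a : C, RIsId (Fhom (idm a));
  Fhom_comp : forall (a b c : C) (g : Hom b c) (f : Hom a b),
      RIsComp (Fhom g) (Fhom f) (Fhom (comp g f))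
}.
Arguments Fhom {C D} F {a b} f : rename.

Definition ess_surjective (C : Category) (D : RelCategory) (F : Functor C D) :=
  forall d : D, exists (c : C) (f : RHom (F c) d) (g : RHom d (F c)),
    (exists i, RIsComp g f i /\ RIsId i) /\ (exists i, RIsComp f g i /\ RIsId i).

Definition property_F (C : Category) (D : RelCategory) (F : Functor C D) :=
  forall d : D, exists (n : nat) (cs : 'I_n -> C)
      (fs : forall i : 'I_n, RHom d (F (cs i))),
    forall (c : C) (f : RHom d (F c)),
      exists (i : 'I_n) (g : Hom (cs i) c), RIsComp (Fhom F g) (fs i) f.

Definition quasi_Groebner (D : RelCategory) : Prop :=
  exists (C : Category) (F : Functor C D),
    [/\ Groebner C, ess_surjective F & property_F F].

(* A planar operadic tree with n vertices (up to isomorphism) is      *)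
(* encoded by (ar, par): vertices are 0..n-1 in their given order;    *)
(* vertex v has half-edges 0..ar v (ar v = its arity); par v = None   *)
(* if the 0-th half-edge of v is the root leaf, and par v = Some(j,k) *)
(* if the 0-th half-edge of v forms an edge with the k-th half-edge   *)
(* of j (1 <= k <= ar j).  All other half-edges (v,k), k>=1, are      *)
(* non-root leaves, ordered in the planar order (lexicographic order  *)
(* of their addresses from the root).                                 *)

Definition rawtree := (seq nat * seq (option (nat * nat)))%type.

Fixpoint lexle (s t : seq nat) : bool :=
  match s, t with
  | [::], _ => true
  | _ :: _, [::] => false
  | a :: s', b :: t' => (a < b) || ((a == b) && lexle s' t')
  end.

Section Tree.
Variable t : rawtree.

Definition nv : nat := size t.1.
Definition ar (v : nat) : nat := nth 0 t.1 v.
Definition par (v : nat) : option (nat * nat) := nth None t.2 v.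
Definition up (o : option nat) : option nat :=
  obind (fun v => omap fst (par v)) o.

Definition tree_wf : bool :=
  [&& size t.2 == nv,
      count (pred1 None) t.2 == 1,
      all (fun v => if par v is Some (j, k) then [&& j < nv, 0 < k & k <= ar j]
                    else true) (iota 0 nv),
      all (fun v => all (fun w => (par v != None) ==> (par v == par w) ==> (v == w))
                        (iota 0 nv)) (iota 0 nv)
    & all (fun v => iter nv up (Some v) == None) (iota 0 nv)].

Definition root : nat := find (pred1 None) t.2.

Fixpoint vaddr (m v : nat) : seq nat :=
  match m with
  | 0 => [::]
  | m'.+1 => if par v is Some (j, k) then rcons (vaddr m' j) k else [::]
  end.

Definition haddr (h : nat * nat) : seq nat := rcons (vaddr nv h.1) h.2.

Definition nonroot_leaves : seq (nat * nat) :=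
  flatten [seq [seq (v, k) | k <- [seq k <- iota 1 (ar v) | Some (v, k) \notin t.2]]
          | v <- iota 0 nv].

Definition leaves : seq (nat * nat) :=
  (root, 0) :: sort (fun h h' => lexle (haddr h) (haddr h')) nonroot_leaves.

Definition nleaves : nat := size leaves.
Definition leaf (i : nat) : nat * nat := nth (0, 0) leaves i.
End Tree.

Definition corolla (a : nat) : rawtree := ([:: a], [:: None]).

(* Planar operadic trees (they automatically have >= 1 vertex). *)
Definition PTree := {t : rawtree | tree_wf t}.

(* is_subst p q qs sg : the data (q_0,...,q_{n-1}; sg) is a morphism
   p -> q of C(nupOp)^op: sg l = list of images (in q) of the vertices of
   q_l, in increasing order, the union being a bijection onto V(q), and
   q is the substitution of the q_l into the vertices of p. *)
Definition is_subst (p q : rawtree) (qs : seq rawtree) (sg : seq (seq nat)) : bool :=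
  let Q l := nth (corolla 0) qs l in
  let S l := nth [::] sg l in
  let img l u := nth 0 (S l) u in
  [&& size qs == nv p, size sg == nv p,
      all (fun l => [&& size (S l) == nv (Q l), sorted ltn (S l)
                      & nleaves (Q l) == (ar p l).+1]) (iota 0 (nv p)),
      perm_eq (flatten sg) (iota 0 (nv q)),
      all (fun l => all (fun u =>
          (ar q (img l u) == ar (Q l) u) &&
          (par q (img l u) ==
             match par (Q l) u with
             | Some (u', k) => Some (img l u', k)
             | None => match par p l with
                       | None => None
                       | Some (j, k) => let h := leaf (Q j) k in Some (img j h.1, h.2)
                       end
             end)) (iota 0 (nv (Q l)))) (iota 0 (nv p))
    & all (fun k => let h := leaf p k in let h' := leaf (Q h.1) h.2 in
                    leaf q k == (img h.1 h'.1, h'.2)) (iota 0 (nleaves p))].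

Definition nupHom (p q : PTree) : Type :=
  {m : seq PTree * seq (seq nat) | is_subst (val p) (val q) (map val m.1) m.2}.

Definition mtrees (p q : PTree) (f : nupHom p q) : seq rawtree := map val (val f).1.
Definition mshuf (p q : PTree) (f : nupHom p q) : seq (seq nat) := (val f).2.

(* h = g o f, where composition is iterated substitution:
   for each vertex l of p, the tree of h at l is the substitution of the
   trees of g (at the vertices sg_l(u) of q) into the tree q_l of f, and
   the vertex bijection of h is the composite of the bijections. *)
Definition nup_is_comp (p q r : PTree) (g : nupHom q r) (f : nupHom p q)
    (h : nupHom p r) : Prop :=
  let Q l := nth (corolla 0) (mtrees f) l in
  let img l u := nth 0 (nth [::] (mshuf f) l) u in
  let R w := nth (corolla 0) (mtrees g) w in
  forall l, l < nv (val p) ->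
    exists rho : seq (seq nat),
      is_subst (Q l) (nth (corolla 0) (mtrees h) l)
               [seq R (img l u) | u <- iota 0 (nv (Q l))] rho /\
      forall u x, u < nv (Q l) -> x < nv (R (img l u)) ->
        nth 0 (nth [::] (mshuf h) l) (nth 0 (nth [::] rho u) x)
        = nth 0 (nth [::] (mshuf g) (img l u)) x.

Definition nup_is_id (p : PTree) (h : nupHom p p) : Prop :=
  mtrees h = [seq corolla (ar (val p) l) | l <- iota 0 (nv (val p))] /\
  mshuf h = [seq [:: l] | l <- iota 0 (nv (val p))].

Definition C_nupOp_op : RelCategory :=
  {| ROb := PTree; RHom := nupHom;
     RIsComp := nup_is_comp; RIsId := nup_is_id |}.

(* Main.v *)
From mathcomp Require Import all_boot.
From Stdlib Require Import Classical ClassicalEpsilon.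
Require Import Defs.
Set Implicit Arguments.
Unset Strict Implicit.
Unset Printing Implicit Defensive.

(** A morphism [p -> q] amounts to contracting [q] onto [p], and it is determined by the
    map sending a vertex of [p] to the root of its fibre in [q].  Writing every vertex and
    leaf as its address from the root, the maps arising in this way are exactly those
    that, extended by "[k]-th leaf to [k]-th leaf", preserve the prefix order and the
    left-to-right order of addresses.  Such embeddings compose as functions, and the
    category they form is isomorphic to C(nupOp)^op, so it suffices to show that it is
    Groebner.  Comparing embeddings lexicographically by the images of the vertices of
    the source is admissible because embeddings are strictly monotone.  Given embeddings
    [p -> q_n], label each node of [q_n] by its preimage in [p]; Kruskal's theorem with
    this finite label set yields [i < j] and a label-preserving embedding [q_i -> q_j],
    and preservation of labels says precisely that it factors the j-th one. *)

(** * Well-quasi-orders and Kruskal's theorem *)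

(** The conditions on an embedding involve addresses only, never the vertex numbering; the shuffle
    of a morphism is recovered because the fibre over [l] consists of the vertices of [q] whose
    nearest ancestor-or-self in the image is the image of [l]. Prefix order and left-to-right order
    are both recorded, since they are what puts the leaves of a fibre in the order of the half-edges
    of [l]. Leaves are treated as nodes on a par with vertices: equality of leaf numbers excludes
    surplus leaves in a fibre, and it also makes the label set finite, as every [q_n] has as many
    leaves as [p]. Kruskal's theorem is needed for ordered children, hence the use of Higman's
    lemma. The encoding of trees is not inductive, so the theorem is applied to pairs of a tree and
    a node in it, and embeddings between such pairs act on addresses relative to the node. The
    functor is full and the identity on objects, which settles essential surjectivity and property
    (F). *)

Lemma nat_least (P : nat -> Prop) :
  (exists n, P n) -> exists n, P n /\ forall k, P k -> n <= k.
Proof.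
case=> n; elim/ltn_ind: n => n IH Pn.
case: (classic (exists k, k < n /\ P k)) => [[k [kn Pk]]|none]; first exact: IH kn Pk.
exists n; split=> // k Pk; rewrite leqNgt; apply/negP => kn; apply: none; by exists k.
Qed.

Lemma choice_fun (A B : Type) (P : A -> B -> Prop) :
  (forall a, exists b, P a b) -> exists f : A -> B, forall a, P a (f a).
Proof.
move=> H; exists (fun a => proj1_sig (constructive_indefinite_description _ (H a))) => a.
exact: proj2_sig.
Qed.

Section WellQuasiOrder.
Variable T : Type.
Variable R : T -> T -> Prop.

Definition bad (s : nat -> T) := forall i j, i < j -> ~ R (s i) (s j).

Definition wqo_on (A : T -> Prop) :=
  forall s : nat -> T, (forall n, A (s n)) -> ~ bad s.

Lemma minimal_bad_sequence (A : T -> Prop) (m : T -> nat) :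
  ~ wqo_on A ->
  exists s, [/\ forall n, A (s n), bad s &
    forall n s', (forall k, A (s' k)) -> bad s' -> (forall i, i < n -> s' i = s i) ->
      m (s n) <= m (s' n)].
Proof.
move=> notwqo.
pose B s := (forall n, A (s n)) /\ bad s.
have [s0 Bs0] : exists s, B s.
  by apply: NNPP => none; apply: notwqo => s As bs; apply: none; exists s.
have stepP (ns : nat * (nat -> T)) : exists s' : nat -> T, B ns.2 ->
    [/\ B s', forall i, i < ns.1 -> s' i = ns.2 i &
      forall s'', B s'' -> (forall i, i < ns.1 -> s'' i = ns.2 i) ->
        m (s' ns.1) <= m (s'' ns.1)].
  case: ns => n s /=; case: (classic (B s)) => [Bs|nB]; last by exists s.
  have [] := @nat_least (fun k => exists s', [/\ B s', forall i, i < n -> s' i = s i & m (s' n) = k]).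
    by exists (m (s n)), s.
  move=> k [[s' [Bs' es' <-]] mink]; exists s' => _; split=> // s'' Bs'' es''.
  by apply: mink; exists s''.
have [step stepE] := choice_fun stepP.
(* [u n] is final below index [n], so the limit sequence is the diagonal [u n.+1 n]. *)
pose u := fix u n := if n is k.+1 then step (k, u k) else s0.
have Bu n : B (u n) by elim: n => //= n IH; case: (stepE (n, u n) IH).
have u_agree n i d : i < n -> u (n + d) i = u n i.
  move=> lt_in; elim: d => [|d <-]; first by rewrite addn0.
  rewrite addnS /=; case: (stepE (n + d, u (n + d)) (Bu _)) => _ /= agree _.
  by apply: agree; exact: ltn_addr.
have u_lim n i : i < n -> u n i = u i.+1 i.
  by move=> lt_in; rewrite -(subnKC lt_in) u_agree.
exists (fun n => u n.+1 n); split=> [n|i j lt_ij|n s' As' bs' es'].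
- by case: (Bu n.+1).
- rewrite -(u_lim j.+1 i) ?ltnS 1?ltnW //; case: (Bu j.+1) => _; exact.
- case: (stepE (n, u n) (Bu n)) => _ _; apply=> // i /= lt_in.
  by rewrite es' // u_lim.
Qed.

(** Entries without an [R]-larger later entry stop at some index, as infinitely many of them would
    form a bad sequence. From there on a chain can always be continued. *)
Lemma wqo_increasing (A : T -> Prop) (s : nat -> T) :
  (forall x y z, R x y -> R y z -> R x z) -> wqo_on A -> (forall n, A (s n)) ->
  exists g : nat -> nat, (forall i j, i < j -> g i < g j) /\
    (forall i j, i < j -> R (s (g i)) (s (g j))).
Proof.
move=> Rtr wqoA As.
have [N HN] : exists N, forall n, N <= n -> exists k, n < k /\ R (s n) (s k).
  apply: NNPP => none.
  have /choice_fun[f fP] : forall N, exists n, N <= n /\ forall k, n < k -> ~ R (s n) (s k).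
    move=> N; apply: NNPP => no; apply: none; exists N => n leNn; apply: NNPP => nok.
    by apply: no; exists n; split=> // k ltnk Rnk; apply: nok; exists k.
  pose t := fix t n := if n is k.+1 then f (t k).+1 else f 0.
  have tmono : {homo t : i j / i < j >-> i < j}.
    apply: homo_ltn => [y x z|i /=]; first exact: ltn_trans.
    by case: (fP (t i).+1).
  apply: (wqoA (s \o t) (fun n => As (t n))) => i j /tmono lt_ij.
  by case: i lt_ij => [|i] /=; [case: (fP 0) | case: (fP (t i).+1)] => _; apply.
have /choice_fun[f fP] : forall n, exists k, N <= n -> n < k /\ R (s n) (s k).
  move=> n; case: (leqP N n) => [/HN[k Hk]|_]; last by exists 0.
  by exists k.
pose g := fix g n := if n is k.+1 then f (g k) else N.
have gN n : N <= g n.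
  by elim: n => //= n IH; case: (fP _ IH) => /ltnW lt _; exact: leq_trans IH lt.
exists g; split.
  have gmono : {homo g : i j / i < j >-> i < j}; last by [].
  apply: homo_ltn => [y x z|i /=]; first exact: ltn_trans.
  by case: (fP _ (gN i)).
have gmono : {homo s \o g : i j / i < j >-> R i j}; last by [].
apply: homo_ltn => [y x z|i /=]; first exact: Rtr.
by case: (fP _ (gN i)).
Qed.

Variable x0 : T.

(** The index function is explicit because positions of children later become digits of
    addresses. *)
Definition list_emb (ss ts : seq T) := exists f : nat -> nat,
  [/\ forall i j, i < j -> j < size ss -> f i < f j,
      forall i, i < size ss -> f i < size ts &
      forall i, i < size ss -> R (nth x0 ss i) (nth x0 ts (f i))].

Lemma list_emb_trans :
  (forall x y z, R x y -> R y z -> R x z) ->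
  forall ss ts us, list_emb ss ts -> list_emb ts us -> list_emb ss us.
Proof.
move=> Rtr ss ts us [f [fm fs fR]] [g [gm gs gR]]; exists (g \o f); split=> /=.
- by move=> i j lt_ij ltj; apply: gm; [exact: fm | exact: fs].
- by move=> i lti; exact/gs/fs.
- by move=> i lti; apply: Rtr (fR _ lti) (gR _ (fs _ lti)).
Qed.

Lemma list_emb_skip ss t ts : list_emb ss ts -> list_emb ss (t :: ts).
Proof.
move=> [f [fm fs fR]]; exists (fun i => (f i).+1); split=> //= i lti.
Qed.

Lemma list_emb_cons s ss t ts : R s t -> list_emb ss ts -> list_emb (s :: ss) (t :: ts).
Proof.
move=> Rst [f [fm fs fR]]; exists (fun i => if i is i'.+1 then (f i').+1 else 0); split.
- by move=> [|i] [|j] //= lt_ij ltj; apply: fm.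
- by case=> //= i lti; exact: fs.
- by case=> //= i lti; exact: fR.
Qed.
End WellQuasiOrder.

(* Nash-Williams' trick: replacing the tail of a minimal bad sequence from index [n]
   on by strictly smaller elements yields a sequence that can no longer be bad. *)
Lemma minimal_bad_replace (T : Type) (R : T -> T -> Prop) (A : T -> Prop) (m : T -> nat)
    (s c : nat -> T) (g : nat -> nat) :
  (forall n, A (s n)) -> bad R s ->
  (forall n s', (forall k, A (s' k)) -> bad R s' -> (forall i, i < n -> s' i = s i) ->
      m (s n) <= m (s' n)) ->
  (forall i, A (c i)) -> (forall i, g 0 <= g i) ->
  (forall i, m (c i) < m (s (g i))) -> (forall x i, R x (c i) -> R x (s (g i))) ->
  ~ bad R c.
Proof.
move=> As bs mins Ac g0 mc Rc bc.
pose s' i := if i < g 0 then s i else c (i - g 0).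
have := mins (g 0) s'; rewrite /s' ltnn subnn leqNgt mc => H; apply: notF; apply: H.
- by move=> k; case: ifP.
- move=> i j lt_ij; case: ifP => lti; case: ifP => ltj.
  + exact: bs.
  + move=> /Rc; apply: bs; exact: leq_trans lti (g0 _).
  + by move: (ltn_trans lt_ij ltj); rewrite lti.
  + by apply: bc; rewrite ltn_sub2r // (leq_trans _ lt_ij) // ltnS leqNgt lti.
- by move=> i ->.
Qed.

(** No list in a minimal bad sequence is empty. Along a subsequence with increasing heads,
    comparable tails would make the lists comparable, so the tails would form a bad sequence of
    shorter lists. *)
Lemma higman (T : Type) (R : T -> T -> Prop) (x0 : T) (A : T -> Prop) :
  (forall x y z, R x y -> R y z -> R x z) -> wqo_on R A ->
  wqo_on (list_emb R x0) (fun ss => forall i, i < size ss -> A (nth x0 ss i)).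
Proof.
move=> Rtr wqoA; apply: NNPP => /(minimal_bad_sequence (@size T))[s [As bs mins]].
have s0 n : 0 < size (s n).
  case sn0: (s n) => [|//]; case: (bs n n.+1 (leqnn _)); rewrite sn0.
  by exists id.
have sE n : s n = head x0 (s n) :: behead (s n) by case: (s n) (s0 n).
have [g [gm gR]] := wqo_increasing (s := fun n => head x0 (s n)) Rtr wqoA
  (fun n => eq_ind _ A (As n 0 (s0 n)) _ (nth0 x0 (s n))).
apply: (minimal_bad_replace (A := fun ss => forall i, i < size ss -> A (nth x0 ss i))
  As bs mins (c := fun i => behead (s (g i))) (g := g)).
- by move=> i k; rewrite size_behead nth_behead => lt; apply: As; rewrite -ltn_predRL.
- by case=> // i; apply/ltnW/gm.
- by move=> i; rewrite size_behead prednK.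
- by move=> ss i; rewrite [s (g i)]sE; exact: list_emb_skip.
- move=> i j lt_ij emb; apply: (bs _ _ (gm _ _ lt_ij)); rewrite (sE (g i)) (sE (g j)).
  apply: list_emb_cons emb; exact: gR.
Qed.

(** [R] enters through transitivity and two closure rules: passing to a parent ([Rsub]) and
    embedding the children of equally labelled nodes ([Rnode]). The children in a minimal bad
    sequence are well-quasi-ordered, so their lists are too by Higman's lemma, and the pigeonhole
    principle on [K] labels finds a pair for [Rnode]. *)
Lemma kruskal (T : Type) (R : T -> T -> Prop) (x0 : T) (A : T -> Prop)
    (lab : T -> nat) (K : nat) (ch : T -> seq T) (m : T -> nat) :
  (forall x y z, R x y -> R y z -> R x z) ->
  (forall x, A x -> lab x < K) ->
  (forall x i, A x -> i < size (ch x) -> A (nth x0 (ch x) i)) ->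
  (forall x i, A x -> i < size (ch x) -> m (nth x0 (ch x) i) < m x) ->
  (forall x y i, A y -> i < size (ch y) -> R x (nth x0 (ch y) i) -> R x y) ->
  (forall x y, A x -> A y -> lab x = lab y -> list_emb R x0 (ch x) (ch y) -> R x y) ->
  wqo_on R A.
Proof.
move=> Rtr labK Ach mch Rsub Rnode.
apply: NNPP => /(minimal_bad_sequence m)[s [As bs mins]].
pose child x c := exists2 i, i < size (ch x) & c = nth x0 (ch x) i.
have wqoC : wqo_on R (fun c => exists n, child (s n) c).
  move=> c /choice_fun[g gP] bc.
  (* Starting at an entry whose parent has least index provides the hypothesis [g 0 <= g i] of the
     replacement lemma. *)
  have [_ [[i0 <-] gmin]] := @nat_least (fun k => exists i, g i = k) (ex_intro _ _ (ex_intro _ 0 erefl)).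
  apply: (minimal_bad_replace As bs mins (c := fun i => c (i0 + i)) (g := fun i => g (i0 + i))).
  - by move=> i; have [k ltk ->] := gP (i0 + i); exact: Ach.
  - by move=> i; rewrite addn0; apply: gmin; eexists.
  - by move=> i; have [k ltk ->] := gP (i0 + i); exact: mch.
  - by move=> x i; have [k ltk ->] := gP (i0 + i); exact: Rsub.
  - by move=> i j lt_ij; apply: bc; rewrite ltn_add2l.
have [|g [gm gR]] := wqo_increasing (s := fun n => ch (s n)) (list_emb_trans Rtr) (higman (x0 := x0) Rtr wqoC).
  by move=> n i lti; exists n, i.
have [i [j [lt_ij eq_ij]]] : exists i j, i < j /\ lab (s (g i)) = lab (s (g j)).
  pose f (i : 'I_K.+1) : 'I_K := Ordinal (labK _ (As (g i))).
  have /injectivePn[i [j ne_ij /(congr1 val) /= eq_ij]] : ~~ injectiveb f.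
    by apply/negP => /injectiveP/leq_card; rewrite !card_ord ltnn.
  case: (ltngtP i j) => [lt|lt|/val_inj eq]; last by rewrite eq eqxx in ne_ij.
    by exists i, j.
  by exists j, i.
apply: (bs _ _ (gm _ _ lt_ij)); apply: Rnode => //; exact: gR.
Qed.

(** * Addresses and the lexicographic order *)

(** Strictly to the left, with neither address a prefix of the other. It is split off from [lexle],
    which also contains the prefix order, because embeddings must preserve the two relations
    separately. *)
Fixpoint dvg (s t : seq nat) : bool :=
  match s, t with
  | a :: s', b :: t' => (a < b) || ((a == b) && dvg s' t')
  | _, _ => false
  end.

Lemma lexleE s t : lexle s t = prefix s t || dvg s t.
Proof.
elim: s t => [|a s IH] [|b t] //=; rewrite IH eq_sym.
by case: ltngtP => //= ->; rewrite orbF.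
Qed.

Lemma prefix_cat2l (c s t : seq nat) : prefix (c ++ s) (c ++ t) = prefix s t.
Proof. by elim: c => //= a c ->; rewrite eqxx. Qed.

Lemma dvg_cat2l c s t : dvg (c ++ s) (c ++ t) = dvg s t.
Proof. by elim: c => //= a c ->; rewrite eqxx ltnn. Qed.

Lemma dvg_cat u v s t : dvg s t -> dvg (s ++ u) (t ++ v).
Proof.
elim: s t => [|a s IH] [|b t] //= /orP[->//|/andP[-> /IH ->]].
by rewrite orbT.
Qed.

Lemma dvg_prefix s t s' t' : dvg s t -> prefix s s' -> prefix t t' -> dvg s' t'.
Proof. by move=> st /prefixP[u ->] /prefixP[v ->]; exact: dvg_cat. Qed.

Lemma dvg_irr s : dvg s s = false.
Proof. by elim: s => //= a s ->; rewrite ltnn andbF. Qed.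

Lemma dvg_asym s t : dvg s t -> dvg t s = false.
Proof.
elim: s t => [|a s IH] [|b t] //=; rewrite eq_sym.
by case: ltngtP => //= _ /IH.
Qed.

Lemma dvg_nprefix s t : dvg s t -> prefix s t = false.
Proof.
by move=> st; apply/negP => /prefixP[u tE]; move: st; rewrite tE -{1}[s]cats0 dvg_cat2l; case: u {tE}.
Qed.

Lemma dvg_nprefixr s t : dvg s t -> prefix t s = false.
Proof.
by move=> st; apply/negP => /prefixP[u tE]; move: st; rewrite tE -{2}[t]cats0 dvg_cat2l; case: u {tE}.
Qed.

Variant address_spec (s t : seq nat) : bool -> bool -> bool -> bool -> Prop :=
  | AddressEq of s = t : address_spec s t true true false false
  | AddressPre of prefix s t & s <> t : address_spec s t true false false false
  | AddressExt of prefix t s & s <> t : address_spec s t false true false false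
  | AddressLeft of dvg s t : address_spec s t false false true false
  | AddressRight of dvg t s : address_spec s t false false false true.

Lemma prefix_anti (s t : seq nat) : prefix s t -> prefix t s -> s = t.
Proof.
move=> st ts; have := size_prefix ts; rewrite -subn_eq0.
by case/prefixP: st => u ->; rewrite size_cat addKn => /nilP ->; rewrite cats0.
Qed.

Lemma addressP s t : address_spec s t (prefix s t) (prefix t s) (dvg s t) (dvg t s).
Proof.
have tot : [|| prefix s t, prefix t s, dvg s t | dvg t s].
  elim: s t => [|a s IH] [|b t] //=; rewrite eq_sym.
  by case: ltngtP => //= ab; rewrite ?orbT //; exact: IH.
case st : (dvg s t).
  by rewrite (dvg_nprefix st) (dvg_nprefixr st) (dvg_asym st); constructor.
case ts : (dvg t s).
  by rewrite (dvg_nprefix ts) (dvg_nprefixr ts); constructor.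
case pst : (prefix s t).
  case pts : (prefix t s); first by constructor; exact: prefix_anti.
  by constructor=> // eq; rewrite eq prefix_refl in pts.
case pts : (prefix t s).
  by constructor=> // eq; rewrite eq prefix_refl in pst.
by rewrite st ts pst pts in tot.
Qed.

Lemma prefix_rcons_r (s t : seq nat) x : prefix s (rcons t x) = (s == rcons t x) || prefix s t.
Proof.
elim: s t => [|a s IH] [|b t] //=.
  by rewrite eqseq_cons orbF; case: s {IH}.
by rewrite eqseq_cons IH andb_orr.
Qed.

Lemma prefix_next (s t : seq nat) : prefix s t -> s <> t -> exists k, prefix (rcons s k) t.
Proof.
case/prefixP=> -[|k u] ->; first by rewrite cats0.
by move=> _; exists k; rewrite -cat_rcons prefix_prefix.
Qed.

(** The case split for inductions on parents: two nodes diverge either at a common parent, or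
    because the parent of one already diverges from the other. *)
Lemma dvg_rcons s t a b : dvg (rcons s a) (rcons t b) ->
  [\/ s = t /\ a < b, dvg s (rcons t b) | dvg (rcons s a) t].
Proof.
elim: s t => [|x s IH] [|y t] /=.
- by rewrite andbF orbF => ab; constructor 1.
- by case/orP=> [ab|/andP[_]]; [constructor 3; rewrite ab | case: t].
- by case/orP=> [ab|/andP[_]]; [constructor 2; rewrite ab | case: s {IH}].
- case/orP=> [->|/andP[/eqP-> /IH[[-> ab]|H|H]]]; first by constructor 2.
  + by constructor 1.
  + by constructor 2; rewrite eqxx H orbT.
  + by constructor 3; rewrite eqxx H orbT.
Qed.

Lemma dvg_rcons_same s a b : dvg (rcons s a) (rcons s b) = (a < b).
Proof. by rewrite -!cats1 dvg_cat2l /= andbF orbF. Qed.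

Lemma lexle_refl s : lexle s s.
Proof. by rewrite lexleE prefix_refl. Qed.

Lemma lexle_anti : antisymmetric lexle.
Proof.
by move=> s t; rewrite !lexleE; case: (addressP s t).
Qed.

Lemma lexle_total : total lexle.
Proof. by move=> s t; rewrite !lexleE; case: (addressP s t). Qed.

Lemma lexle_trans : transitive lexle.
Proof.
move=> t s u; elim: s t u => [|a s IH] [|b t] [|c u] //=.
case/orP=> [ab|/andP[/eqP<- st]]; case/orP=> [bc|/andP[/eqP<- tu]].
- by rewrite (ltn_trans ab bc).
- by rewrite ab.
- by rewrite bc.
- by rewrite (IH _ _ st tu) eqxx orbT.
Qed.

(** * Raw trees *)

Notation addr t v := (vaddr t (nv t) v).

Definition slot (t : rawtree) (h : nat * nat) : bool := (h.1 < nv t) && (0 < h.2 <= ar t h.1).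

Section TreeTheory.
Variable t : rawtree.
Hypothesis wf : tree_wf t.

Lemma size_par : size t.2 = nv t.
Proof. by case/and5P: wf => /eqP. Qed.

Lemma par_wf v j k : par t v = Some (j, k) ->
  [/\ v < nv t, slot t (j, k) & j < nv t].
Proof.
move=> pv; have ltv : v < nv t.
  by rewrite ltnNge; apply/negP => gev; move: pv; rewrite /par nth_default ?size_par.
case/and5P: wf => _ _ /allP /(_ v) + _ _.
by rewrite mem_iota ltv pv /slot => /(_ isT) /and3P[-> -> ->].
Qed.

Lemma par_mem h : reflect (exists2 v, v < nv t & par t v = Some h) (Some h \in t.2).
Proof.
apply: (iffP idP) => [|[v ltv <-]]; last by rewrite mem_nth ?size_par.
by move/(nthP None) => [v ltv vE]; exists v; rewrite -?size_par.
Qed.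

Lemma parE : t.2 = [seq par t v | v <- iota 0 (nv t)].
Proof. by rewrite -size_par; exact/esym/mkseq_nth. Qed.

Lemma root_lt : root t < nv t.
Proof. by case/and5P: wf => _ /eqP c1 _ _ _; rewrite -size_par -has_find has_count c1. Qed.

Lemma par_root : par t (root t) = None.
Proof.
apply/eqP; apply: (@nth_find _ None (pred1 None) t.2).
by case/and5P: wf => _ /eqP c1 _ _ _; rewrite has_count c1.
Qed.

Lemma root_unique v : v < nv t -> par t v = None -> v = root t.
Proof.
move=> ltv pv; apply/eqP/negPn/negP => ne.
case/and5P: wf => _ + _ _ _; rewrite parE count_map => /eqP c1.
suff : 2 <= 1 by [].
rewrite -{2}c1 -size_filter -[2]/(size [:: v; root t]); apply: uniq_leq_size.
  by rewrite /= inE ne.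
move=> w; rewrite !inE mem_filter mem_iota /= => /orP[]/eqP->.
  by rewrite pv eqxx.
by rewrite par_root eqxx root_lt.
Qed.

Lemma par_inj v w h : par t v = Some h -> par t w = Some h -> v = w.
Proof.
case: h => j k pv pw; have [ltv _ _] := par_wf pv; have [ltw _ _] := par_wf pw.
case/and5P: wf => _ _ _ /allP /(_ v) + _; rewrite mem_iota ltv => /(_ isT) /allP /(_ w).
by rewrite mem_iota ltw pv pw !eqxx => /(_ isT) /eqP.
Qed.

Lemma iter_up_None m : iter m (up t) None = None.
Proof. by elim: m => //= m ->. Qed.

(** Well-foundedness is the last clause of [tree_wf]: iterating [up] reaches [None]. *)
Lemma tree_ind (P : nat -> Prop) :
  (forall v, v < nv t -> (forall j k, par t v = Some (j, k) -> P j) -> P v) ->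
  forall v, v < nv t -> P v.
Proof.
move=> IH v ltv; case/and5P: wf => _ _ _ _ /allP /(_ v).
rewrite mem_iota ltv => /(_ isT) /eqP; move: (X in iter X) => m.
elim: m v ltv => // m IHm v ltv; rewrite iterSr => itv; apply: IH => // j k pv.
have [_ _ ltj] := par_wf pv; apply: IHm => //; by rewrite /= pv in itv.
Qed.

Lemma addr_root : addr t (root t) = [::].
Proof. by case: (nv t) => //= n; rewrite par_root. Qed.

(** [vaddr] recurses on fuel. The ancestors of [j] run out one step earlier than those of [v], so
    one unit less of fuel gives the same address for [j]. *)
Lemma addr_child v j k : par t v = Some (j, k) -> addr t v = rcons (addr t j) k.
Proof.
move=> pv; have [ltv _ ltj] := par_wf pv.
case/and5P: wf => _ _ _ _ /allP /(_ v); rewrite mem_iota ltv => /(_ isT) /eqP.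
have stable m : forall u, iter m (up t) (Some u) = None -> vaddr t m.+1 u = vaddr t m u.
  elim: m => // m IHm u; rewrite iterSr /=; case: (par t u) => [[i l]|] //= itu.
  by rewrite -(IHm i itu).
by case: (nv t) => // n; rewrite iterSr /= pv /= => /stable <-.
Qed.

Lemma addr_inj v w : v < nv t -> w < nv t -> addr t v = addr t w -> v = w.
Proof.
move=> ltv; move: v ltv w; apply: tree_ind => v ltv IH w ltw.
case pv : (par t v) => [[j k]|]; case pw : (par t w) => [[j' k']|].
- rewrite (addr_child pv) (addr_child pw) => /rcons_inj[eqa eqk].
  have [_ _ ltj'] := par_wf pw.
  by apply: (par_inj pv); rewrite pw eqk (IH _ _ pv _ ltj' eqa).
- by rewrite (addr_child pv) (root_unique ltw pw) addr_root; case: (addr t j).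
- by rewrite (addr_child pw) (root_unique ltv pv) addr_root; case: (addr t j').
- by rewrite (root_unique ltw pw) (root_unique ltv pv).
Qed.

Lemma haddr_inj h h' : slot t h -> slot t h' -> haddr t h = haddr t h' -> h = h'.
Proof.
case: h h' => v k [w i] /andP[ltv _] /andP[ltw _] /rcons_inj[eqa ->].
by have /= -> := addr_inj ltv ltw eqa.
Qed.

Lemma prefix_slot_child v k w : v < nv t -> w < nv t ->
  prefix (rcons (addr t v) k) (addr t w) ->
  exists u, [/\ u < nv t, par t u = Some (v, k) & prefix (addr t u) (addr t w)].
Proof.
move=> ltv ltw; move: w ltw; apply: tree_ind => w ltw IH.
case pw : (par t w) => [[j i]|]; last first.
  by rewrite (root_unique ltw pw) addr_root prefixs0; case: (addr t v).
have [_ _ ltj] := par_wf pw.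
rewrite (addr_child pw) prefix_rcons_r => /orP[/eqP/rcons_inj[eqa eqk]|pre].
  exists w; rewrite (addr_child pw) prefix_refl; split=> //.
  by rewrite pw eqk (addr_inj ltv ltj eqa).
have [u [ltu pu preu]] := IH _ _ pw pre.
by exists u; split=> //; apply: prefix_trans preu (prefix_rcons _ _).
Qed.

Lemma mem_nonroot_leaves h : (h \in nonroot_leaves t) = slot t h && (Some h \notin t.2).
Proof.
case: h => v k; apply/allpairsPdep/idP => [[w [i [+ + [-> ->]]]]|].
  by rewrite mem_iota mem_filter mem_iota add1n ltnS /slot /= => -> /andP[-> ->].
case/andP=> /andP[ltv /andP[k0 lek]] nch; exists v, k.
by rewrite mem_iota mem_filter mem_iota nch k0 add1n ltnS.
Qed.

Lemma nonroot_leaves_uniq : uniq (nonroot_leaves t).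
Proof.
apply: allpairs_uniq_dep; first exact: iota_uniq.
  by move=> v _; exact/filter_uniq/iota_uniq.
by move=> [v k] [w i] _ _ /= [-> ->].
Qed.

Lemma leaf0 : leaf t 0 = (root t, 0).
Proof. by []. Qed.

Lemma nleavesE : nleaves t = (size (nonroot_leaves t)).+1.
Proof. by rewrite /nleaves /= size_sort. Qed.

Lemma leaf_mem k : 0 < k < nleaves t -> leaf t k \in nonroot_leaves t.
Proof.
case: k => //= k; rewrite nleavesE ltnS /leaf /= => ltk.
by rewrite -(mem_sort (fun h h' => lexle (haddr t h) (haddr t h'))) mem_nth // size_sort.
Qed.

Lemma leaf_slot k : 0 < k < nleaves t -> slot t (leaf t k).
Proof. by move/leaf_mem; rewrite mem_nonroot_leaves => /andP[]. Qed.

Lemma leaf_index h : h \in nonroot_leaves t ->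
  0 < index h (leaves t) < nleaves t /\ leaf t (index h (leaves t)) = h.
Proof.
move=> hin; have hl : h \in leaves t by rewrite inE mem_sort hin orbT.
rewrite index_mem hl andbT /leaf nth_index //; split=> //.
rewrite lt0n /=; case: ifP => // /eqP hE; move: hin.
by rewrite -hE mem_nonroot_leaves /slot /= andbF.
Qed.

Lemma leaf_maximal h w i : h \in nonroot_leaves t -> slot t (w, i) ->
  prefix (haddr t h) (haddr t (w, i)) -> h = (w, i).
Proof.
rewrite mem_nonroot_leaves => /andP[sh nch] swi.
rewrite prefix_rcons_r => /orP[/eqP|]; first exact: haddr_inj.
case: h sh nch => v k /andP[/= ltv _] nch pre; case/andP: swi => /= ltw _.
have [u [ltu pu _]] := prefix_slot_child ltv ltw pre.
by case/negP: nch; apply/par_mem; exists u.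
Qed.

(** Sorting only yields [lexle]; its prefix alternative would, by maximality of leaves, identify two
    entries of a duplicate-free list. *)
Lemma leaf_dvg k k' : 0 < k -> k < k' -> k' < nleaves t ->
  dvg (haddr t (leaf t k)) (haddr t (leaf t k')).
Proof.
case: k k' => [|k] [|k'] // _; rewrite ltnS nleavesE ltnS => lt_kk' ltk'.
have ltk := ltn_trans lt_kk' ltk'; pose r h h' := lexle (haddr t h) (haddr t h').
have rtr : transitive r by move=> y x z; exact: lexle_trans.
have rtot : total r by move=> x y; exact: lexle_total.
have srt := sort_sorted rtot (nonroot_leaves t).
have := sorted_ltn_nth rtr (0, 0) srt k k'.
rewrite !inE size_sort => /(_ ltk ltk' lt_kk').
rewrite /r lexleE => /orP[pre|//].
have mem i : i < size (nonroot_leaves t) -> nth (0, 0) (sort r (nonroot_leaves t)) i \in nonroot_leaves t.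
  by move=> lti; rewrite -(mem_sort r) mem_nth // size_sort.
have := mem _ ltk'; rewrite mem_nonroot_leaves => /andP[s' _].
move: pre s'; rewrite [X in haddr t X]surjective_pairing.
case E' : (nth _ _ k') => [w i] pre s'.
have /eqP := leaf_maximal (mem _ ltk) s' pre.
rewrite -E' nth_uniq ?size_sort ?sort_uniq ?nonroot_leaves_uniq //.
by move=> /eqP eqk; rewrite eqk ltnn in lt_kk'.
Qed.

(** A sorted list is determined by its elements. This allows the leaves of a fibre to be computed by
    exhibiting a left-to-right enumeration, without unfolding [sort]. *)
Lemma leaves_unique m (g : nat -> nat * nat) :
  (forall k, 0 < k <= m -> g k \in nonroot_leaves t) ->
  (forall k k', 0 < k -> k < k' -> k' <= m -> dvg (haddr t (g k)) (haddr t (g k'))) ->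
  (forall h, h \in nonroot_leaves t -> exists2 k, 0 < k <= m & g k = h) ->
  nleaves t = m.+1 /\ forall k, 0 < k <= m -> leaf t k = g k.
Proof.
move=> gin gdvg gsurj.
pose r h h' := lexle (haddr t h) (haddr t h').
have rtot : total r by move=> x y; exact: lexle_total.
have ginj : {in iota 1 m &, injective g}.
  move=> k k'; rewrite !mem_iota !add1n !ltnS => /andP[k0 lek] /andP[k0' lek'] eqg.
  case: (ltngtP k k') => // lt.
    by have := gdvg _ _ k0 lt lek'; rewrite eqg dvg_irr.
  by have := gdvg _ _ k0' lt lek; rewrite eqg dvg_irr.
have perm : perm_eq (nonroot_leaves t) (map g (iota 1 m)).
  apply: uniq_perm; [exact: nonroot_leaves_uniq|by rewrite map_inj_in_uniq // iota_uniq|].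
  move=> h; apply/idP/mapP => [/gsurj[k lek <-]|[k]].
    by exists k => //; rewrite mem_iota add1n ltnS.
  by rewrite mem_iota add1n ltnS => /gin ? ->.
suff eqs : sort r (nonroot_leaves t) = map g (iota 1 m).
  rewrite nleavesE (perm_size perm) size_map size_iota; split=> // -[|k] //= lek.
  by rewrite /leaf /leaves -/r eqs /= (nth_map 0) ?size_iota // nth_iota.
have in_slot : all (slot t) (nonroot_leaves t).
  by apply/allP => h; rewrite mem_nonroot_leaves => /andP[].
(* The comparison moves to addresses, where [lexle] is antisymmetric; [haddr t] is injective on
   slots. *)
apply: (inj_in_map (A := [in slot t]) (f := haddr t)) => [h h'| | |].
- exact: haddr_inj.
- by rewrite inE all_sort.
- by rewrite inE -(perm_all _ perm).
apply: (sorted_eq lexle_trans lexle_anti).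
- by rewrite sorted_map; exact: (sort_sorted rtot).
- rewrite -map_comp sorted_map; apply: (@sub_in_sorted _ [in iota 1 m] ltn).
  + move=> k k'; rewrite !mem_iota !add1n !ltnS => /andP[k0 lek] /andP[k0' lek'] lt.
    by rewrite /= lexleE gdvg ?orbT.
  + exact/allP.
  + exact: iota_ltn_sorted.
- by rewrite perm_map // perm_sort.
Qed.
End TreeTheory.

(** * Nodes and induced subtrees *)

(** [inl v] is a vertex and [inr k] the leaf of index [k]. The root leaf, of index 0, is not a valid
    node, so each valid node except the root vertex is the outer end of exactly one slot. *)
Definition node := (nat + nat)%type.

Definition node_addr (t : rawtree) (x : node) : seq nat :=
  match x with inl v => addr t v | inr k => haddr t (leaf t k) end.

Definition node_valid (t : rawtree) (x : node) : bool :=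
  match x with inl v => v < nv t | inr k => 0 < k < nleaves t end.

Definition nodes (t : rawtree) : seq node :=
  map inl (iota 0 (nv t)) ++ map inr (iota 1 (nleaves t).-1).

(** The node at the outer end of [h]; [find] leaves the range of vertices when no vertex hangs
    there. *)
Definition node_at (t : rawtree) (h : nat * nat) : node :=
  let u := find (pred1 (Some h)) t.2 in
  if u < nv t then inl u else inr (index h (leaves t)).

(** The inverse of [node_at]; the value [(0, 0)] at the root vertex is junk and not a slot. *)
Definition slot_of (t : rawtree) (x : node) : nat * nat :=
  match x with inl v => odflt (0, 0) (par t v) | inr k => leaf t k end.

Section NodeTheory.
Variable t : rawtree.
Hypothesis wf : tree_wf t.

Lemma mem_nodes x : (x \in nodes t) = node_valid t x.
Proof.
apply/idP/idP; rewrite mem_cat.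
  case/orP=> /mapP[v + ->]; rewrite mem_iota //=.
case: x => [v|k] /= valx; apply/orP; [left|right]; apply: map_f; rewrite mem_iota //.
Qed.

Lemma node_at_child v h : par t v = Some h -> node_at t h = inl v.
Proof.
move=> pv; have : has (pred1 (Some h)) t.2.
  case: h pv => j k pv; have [ltv _ _] := par_wf wf pv.
  by apply/hasP; exists (Some (j, k)) => //=; apply/(par_mem wf); exists v.
move=> hash; have := hash; rewrite has_find size_par // /node_at => ->.
have /eqP := nth_find None hash; rewrite -/(par t _) => pf.
by rewrite (par_inj wf pv pf).
Qed.

Lemma node_at_leaf h : h \in nonroot_leaves t -> node_at t h = inr (index h (leaves t)).
Proof.
rewrite mem_nonroot_leaves // => /andP[_ nch]; rewrite /node_at -size_par // -has_find.
by case: hasP => // -[o ho /eqP eo]; rewrite -eo ho in nch.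
Qed.

Variant node_at_spec h : node -> Prop :=
  | NodeAtVertex v of v < nv t & par t v = Some h : node_at_spec h (inl v)
  | NodeAtLeaf k of 0 < k < nleaves t & leaf t k = h & h \in nonroot_leaves t :
      node_at_spec h (inr k).

Lemma node_atP h : slot t h -> node_at_spec h (node_at t h).
Proof.
move=> sh; case mem : (Some h \in t.2).
  by have /(par_mem wf)[v ltv pv] := mem; rewrite (node_at_child pv); constructor.
have hin : h \in nonroot_leaves t by rewrite mem_nonroot_leaves // sh mem.
by rewrite node_at_leaf //; have [] := leaf_index hin; constructor.
Qed.

Lemma node_at_valid h : slot t h -> node_valid t (node_at t h).
Proof. by case/node_atP. Qed.

Lemma node_at_addr h : slot t h -> node_addr t (node_at t h) = haddr t h.
Proof.
case/node_atP => [v ltv pv|k ltk <- _] //=.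
by case: h pv => j k pv; rewrite (addr_child wf pv).
Qed.

Lemma slot_of_node_at h : slot t h -> slot_of t (node_at t h) = h.
Proof. by case/node_atP => [v ltv pv|k ltk <- _] //=; rewrite pv. Qed.

Lemma slot_ofP x : node_valid t x -> x <> inl (root t) ->
  slot t (slot_of t x) /\ haddr t (slot_of t x) = node_addr t x.
Proof.
case: x => [v|k] /= valx nr; last by split=> //; exact: leaf_slot.
case pv : (par t v) => [[j k]|]; last by case: nr; rewrite (root_unique wf valx pv).
by have [_ ? _] := par_wf wf pv; rewrite (addr_child wf pv).
Qed.

Lemma leaf_node_maximal k x : 0 < k < nleaves t -> node_valid t x ->
  prefix (node_addr t (inr k)) (node_addr t x) -> x = inr k.
Proof.
move=> ltk valx pre; have lin := leaf_mem ltk.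
have xnr : x <> inl (root t).
  by move=> xE; move: pre; rewrite xE /= addr_root // prefixs0 /haddr; case: (vaddr t _ _).
have [sx ex] := slot_ofP valx xnr; rewrite -ex in pre.
have lx : leaf t k = slot_of t x.
  by rewrite (surjective_pairing (slot_of t x)); apply: (leaf_maximal wf lin);
    rewrite -?surjective_pairing.
case: x valx xnr {pre ex} sx lx => [v|k'] /= valx xnr sx lx.
  case pv : (par t v) => [h|]; last by case: xnr; rewrite (root_unique wf valx pv).
  move: lin; rewrite lx pv mem_nonroot_leaves //= => /andP[_ /negP[]].
  by apply/(par_mem wf); exists v.
case/andP: ltk valx => k0 ltk /andP[k0' ltk'].
case: (ltngtP k k') => [lt|lt|-> //].
  by have := leaf_dvg wf k0 lt ltk'; rewrite lx dvg_irr.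
by have := leaf_dvg wf k0' lt ltk; rewrite lx dvg_irr.
Qed.

Lemma node_addr_inj x y : node_valid t x -> node_valid t y ->
  node_addr t x = node_addr t y -> x = y.
Proof.
case: y => [w|k] valx valy exy; last first.
  by apply: leaf_node_maximal => //; rewrite exy prefix_refl.
case: x valx exy => [v|k] valx exy.
  by rewrite (addr_inj wf valx valy exy).
by rewrite (@leaf_node_maximal k (inl w)) // exy prefix_refl.
Qed.

Lemma node_atE x h : node_valid t x -> slot t h -> node_addr t x = haddr t h -> node_at t h = x.
Proof.
move=> valx sh ex; apply: node_addr_inj; rewrite ?node_at_valid ?node_at_addr //.
Qed.

Lemma prefix_slot v k x : v < nv t -> node_valid t x ->
  prefix (rcons (addr t v) k) (node_addr t x) -> slot t (v, k).
Proof.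
move=> ltv valx pre.
have xnr : x <> inl (root t).
  by move=> xE; move: pre; rewrite xE /= addr_root // prefixs0; case: (addr t _).
have [sx ex] := slot_ofP valx xnr; move: pre; rewrite -ex.
case: (slot_of t x) sx => w i sx; rewrite prefix_rcons_r => /orP[/eqP/rcons_inj[ea ->]|].
  by case/andP: (sx) => /= ltw _; rewrite (addr_inj wf ltv ltw ea).
case/andP: sx => /= ltw _ /(prefix_slot_child wf ltv ltw)[u [_ pu _]].
by have [] := par_wf wf pu.
Qed.

End NodeTheory.

(** Vertices are renumbered by their position in [S], so an increasing [S] keeps the vertex order of
    [t]. Edges leaving [S] are cut and become leaves. *)
Definition sub (t : rawtree) (S : seq nat) : rawtree :=
  ([seq ar t w | w <- S],
   [seq if par t w is Some (j, k) then if j \in S then Some (index j S, k) else None else None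
     | w <- S]).

Section Sub.
Variables (t : rawtree) (S : seq nat).

Lemma nv_sub : nv (sub t S) = size S.
Proof. by rewrite /nv size_map. Qed.

Lemma ar_sub u : u < size S -> ar (sub t S) u = ar t (nth 0 S u).
Proof. by move=> ltu; rewrite /ar (nth_map 0). Qed.

Lemma par_sub u : u < size S -> par (sub t S) u =
  if par t (nth 0 S u) is Some (j, k) then if j \in S then Some (index j S, k) else None else None.
Proof. by move=> ltu; rewrite {1}/par (nth_map 0). Qed.
End Sub.

Lemma sub_unique (t q : rawtree) (S : seq nat) : tree_wf q -> uniq S -> nv q = size S ->
  (forall u, u < nv q -> ar q u = ar t (nth 0 S u)) ->
  (forall u, u < nv q -> forall j k, par q u = Some (j, k) -> par t (nth 0 S u) = Some (nth 0 S j, k)) ->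
  (forall u, u < nv q -> par q u = None -> forall j k, par t (nth 0 S u) = Some (j, k) -> j \notin S) ->
  q = sub t S.
Proof.
move=> wfq uS nvq arq parq parq0; case: q wfq nvq arq parq parq0 => q1 q2 wfq.
have sz2 := size_par wfq; rewrite /nv /= in sz2 *.
move=> nvq arq parq parq0; congr pair.
  by apply: (@eq_from_nth _ 0) => [|u ltu]; rewrite ?size_map // (nth_map 0) -?nvq // -arq.
apply: (@eq_from_nth _ None) => [|u]; rewrite ?size_map ?sz2 // => ltu.
rewrite (nth_map 0) -?nvq // -/(par (q1, q2) u).
case pu : (par (q1, q2) u) => [[j k]|].
  have [_ _ ltj] := par_wf wfq pu.
  by rewrite (parq _ ltu _ _ pu) mem_nth -?nvq // index_uniq -?nvq.
case pt : (par t _) => [[j k]|//].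
by rewrite (negPf (parq0 _ ltu pu _ _ pt)).
Qed.

Lemma count_strict (T : eqType) (a1 a2 : pred T) (x : T) (s : seq T) :
  subpred a1 a2 -> x \in s -> a2 x -> ~~ a1 x -> count a1 s < count a2 s.
Proof.
move=> sub12 + a2x na1x; elim: s => //= y s IH; rewrite inE => /orP[/eqP<-|/IH lt].
  by rewrite a2x (negPf na1x) ltnS sub_count.
rewrite -addnS leq_add //; case a1y : (a1 y) => //; by rewrite sub12.
Qed.

(** A local condition on parents: in a well-formed tree, following parents inside [S] has to end at
    [r]. *)
Definition connected (t : rawtree) (S : seq nat) (r : nat) : Prop :=
  [/\ uniq S, forall w, w \in S -> w < nv t, r \in S,
      forall j k, par t r = Some (j, k) -> j \notin S
    & forall w, w \in S -> w <> r -> exists j k, par t w = Some (j, k) /\ j \in S].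

Section Connected.
Variables (t : rawtree) (S : seq nat) (r : nat).
Hypotheses (wf : tree_wf t) (conn : connected t S r).

Lemma par_sub_root : par (sub t S) (index r S) = None.
Proof.
case: conn => uS _ rS pr _; rewrite par_sub ?index_mem // nth_index //.
by case pE : (par t r) => [[j k]|//]; rewrite (negPf (pr _ _ pE)).
Qed.

Lemma par_sub_nonroot u : u < size S -> u <> index r S ->
  exists j k, [/\ par (sub t S) u = Some (index j S, k), par t (nth 0 S u) = Some (j, k) & j \in S].
Proof.
case: conn => uS _ rS _ cS ltu ne.
have [|j [k [pu jS]]] := cS (nth 0 S u) (mem_nth _ ltu).
  by move=> eu; apply: ne; rewrite -eu index_uniq.
by exists j, k; rewrite par_sub // pu jS.
Qed.

Lemma sub_wf : tree_wf (sub t S).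
Proof.
case: (conn) => uS ltS rS pr cS.
have parS u j k : u < size S -> par (sub t S) u = Some (j, k) ->
    exists w, [/\ w \in S, j = index w S & par t (nth 0 S u) = Some (w, k)].
  move=> ltu pu; have [|ne] := eqVneq u (index r S).
    by move=> uE; rewrite uE par_sub_root in pu.
  have [w [i [pu' pw wS]]] := par_sub_nonroot ltu (elimN eqP ne).
  by move: pu; rewrite pu' => -[<- <-]; exists w.
apply/and5P; split.
- by rewrite nv_sub size_map.
- rewrite /= count_map.
  rewrite (@eq_in_count _ _ (pred1 r)) => [|w wS /=]; first by rewrite count_uniq_mem // rS.
  have [->|/eqP ne] := eqVneq w r.
    by case pE : (par t r) => [[j k]|//]; rewrite (negPf (pr _ _ pE)).
  by have [j [k [-> ->]]] := cS w wS ne.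
- apply/allP => u; rewrite mem_iota ?nv_sub /= add0n => ltu.
  case pu : (par _ u) => [[j k]|//]; have [w [wS -> pw]] := parS _ _ _ ltu pu.
  have [_ /andP[/= _ le_k] _] := par_wf wf pw.
  by rewrite index_mem wS ar_sub ?index_mem // nth_index.
- apply/allP => u; rewrite mem_iota ?nv_sub /= add0n => ltu.
  apply/allP => v; rewrite mem_iota ?nv_sub /= add0n => ltv.
  apply/implyP => pu0; apply/implyP => /eqP puv.
  case pu : (par _ u) pu0 puv => [[j k]|//] _ /esym pv.
  have [w [wS jw pw]] := parS _ _ _ ltu pu; have [w' [wS' jw' pw']] := parS _ _ _ ltv pv.
  have ww' : w = w' by rewrite -(nth_index 0 wS) -jw jw' nth_index.
  rewrite -ww' in pw'; have := par_inj wf pw pw'.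
  by move/eqP; rewrite nth_uniq.
- apply/allP => u; rewrite mem_iota ?nv_sub /= add0n => ltu.
  (* The number of vertices of [S] of smaller depth bounds the depth within [S]. *)
  pose rk u := count (fun u' => size (addr t (nth 0 S u')) < size (addr t (nth 0 S u))) (iota 0 (size S)).
  have rk_par v j k : v < size S -> par (sub t S) v = Some (j, k) -> j < size S /\ rk j < rk v.
    move=> ltv /(parS _ _ _ ltv)[w [wS -> pw]]; rewrite index_mem wS; split=> //.
    have ltw : size (addr t w) < size (addr t (nth 0 S v)) by rewrite (addr_child wf pw) size_rcons.
    rewrite /rk nth_index //; apply: (@count_strict _ _ _ (index w S)).
    + by move=> x /= /ltn_trans; apply.
    + by rewrite mem_iota index_mem.
    + by rewrite nth_index.
    + by rewrite nth_index ?ltnn.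
  have terminates m v : v < size S -> rk v < m -> iter m (up (sub t S)) (Some v) = None.
    elim: m v => // m IH v ltv rkv; rewrite iterSr /=.
    case pv : (par _ v) => [[j k]|] /=; last exact: iter_up_None.
    have [ltj rkj] := rk_par _ _ _ ltv pv; apply: IH => //; exact: leq_trans rkj _.
  apply/eqP; rewrite ?nv_sub; apply: terminates => //.
  rewrite /rk -[X in _ < X](size_iota 0) -[X in _ < X]count_predT.
  by apply: (@count_strict _ _ _ u); rewrite ?mem_iota ?ltnn.
Qed.

Lemma root_sub : root (sub t S) = index r S.
Proof.
case: (conn) => _ _ rS _ _; apply/esym/(root_unique sub_wf); last exact: par_sub_root.
by rewrite nv_sub index_mem.
Qed.

Lemma addr_sub u : u < size S -> addr t (nth 0 S u) = addr t r ++ addr (sub t S) u.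
Proof.
rewrite -(nv_sub t); move: u; apply: (tree_ind sub_wf) => u ltu IH; rewrite nv_sub in ltu.
case: (conn) => _ _ rS _ _.
have [->|/eqP ne] := eqVneq u (index r S).
  by rewrite nth_index // -root_sub addr_root ?cats0 //; exact: sub_wf.
have [j [k [pu pt jS]]] := par_sub_nonroot ltu ne.
by rewrite (addr_child wf pt) (addr_child sub_wf pu) -rcons_cat -(IH _ _ pu) nth_index.
Qed.

Lemma haddr_sub u k : u < size S -> haddr t (nth 0 S u, k) = addr t r ++ haddr (sub t S) (u, k).
Proof. by move=> ltu; rewrite /haddr /= -rcons_cat -addr_sub. Qed.

Lemma mem_nonroot_leaves_sub u k : u < size S ->
  ((u, k) \in nonroot_leaves (sub t S)) =
  slot t (nth 0 S u, k) && ~~ has (fun w => par t w == Some (nth 0 S u, k)) S.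
Proof.
case: (conn) => uS _ _ _ _ ltu; rewrite mem_nonroot_leaves.
have -> : slot (sub t S) (u, k) = slot t (nth 0 S u, k).
  case: (conn) => _ ltS _ _ _.
  by rewrite /slot /= nv_sub ltu ar_sub // ltS // mem_nth.
congr (_ && ~~ _); apply/(par_mem sub_wf)/hasP => [[v]|[w wS /eqP pw]].
  rewrite nv_sub => ltv; rewrite par_sub //; case pv : (par t _) => [[j i]|//].
  case: ifP => // jS [ju <-]; exists (nth 0 S v); first exact: mem_nth.
  by rewrite pv -ju nth_index.
exists (index w S); rewrite ?nv_sub ?index_mem // par_sub ?index_mem // nth_index // pw.
by rewrite mem_nth // index_uniq.
Qed.
End Connected.

(** * From embeddings to substitutions *)

Definition target (rho : nat -> nat) (x : node) : node :=
  match x with inl v => inl (rho v) | inr k => inr k end.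

(** The two relations are preserved and reflected, which yields injectivity and locates preimages;
    [embedding_intro] reduces this to preservation. *)
Record embedding (p q : rawtree) (rho : nat -> nat) : Prop := Embedding {
  emb_lt : forall v, v < nv p -> rho v < nv q;
  emb_root : rho (root p) = root q;
  emb_nleaves : nleaves p = nleaves q;
  emb_prefix : forall x y, node_valid p x -> node_valid p y ->
    prefix (node_addr q (target rho x)) (node_addr q (target rho y)) =
    prefix (node_addr p x) (node_addr p y);
  emb_dvg : forall x y, node_valid p x -> node_valid p y ->
    dvg (node_addr q (target rho x)) (node_addr q (target rho y)) =
    dvg (node_addr p x) (node_addr p y)
}.

(** [rho l] is the last vertex of the image on the path from the root to [w]; being last is measured
    in [p]. *)
Definition infib (p q : rawtree) (rho : nat -> nat) (l w : nat) : bool :=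
  [&& l < nv p, prefix (addr q (rho l)) (addr q w) &
    all (fun l' => prefix (addr q (rho l')) (addr q w) ==> prefix (addr p l') (addr p l))
      (iota 0 (nv p))].

Definition fib (p q : rawtree) (rho : nat -> nat) (l : nat) : seq nat :=
  [seq w <- iota 0 (nv q) | infib p q rho l w].

Definition ftrees (p q : rawtree) (rho : nat -> nat) : seq rawtree :=
  [seq sub q (fib p q rho l) | l <- iota 0 (nv p)].

Definition fibs (p q : rawtree) (rho : nat -> nat) : seq (seq nat) :=
  [seq fib p q rho l | l <- iota 0 (nv p)].

Lemma infibP p q rho l w :
  reflect [/\ l < nv p, prefix (addr q (rho l)) (addr q w) &
    forall l', l' < nv p -> prefix (addr q (rho l')) (addr q w) -> prefix (addr p l') (addr p l)]
  (infib p q rho l w).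
Proof.
apply: (iffP and3P) => -[ltl pre H]; split=> //.
  by move=> l' ltl'; apply/implyP/(allP H); rewrite mem_iota.
by apply/allP => l'; rewrite mem_iota => ltl'; apply/implyP/H.
Qed.

Lemma mem_fib p q rho l w : (w \in fib p q rho l) = (w < nv q) && infib p q rho l w.
Proof. by rewrite mem_filter mem_iota andbC. Qed.

Lemma fib_uniq p q rho l : uniq (fib p q rho l).
Proof. exact/filter_uniq/iota_uniq. Qed.

Lemma fib_sorted p q rho l : sorted ltn (fib p q rho l).
Proof. by apply: sorted_filter; [exact: ltn_trans | exact: iota_ltn_sorted]. Qed.

Section Embedding.
Variables (p q : rawtree) (rho : nat -> nat).
Hypotheses (wfp : tree_wf p) (wfq : tree_wf q) (He : embedding p q rho).

Local Notation tgt := (target rho).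
Local Notation infib := (infib p q rho).
Local Notation fib := (fib p q rho).

Lemma target_valid x : node_valid p x -> node_valid q (tgt x).
Proof. by case: x => [v|k] /=; [exact: emb_lt | rewrite (emb_nleaves He)]. Qed.

Lemma target_inj x y : node_valid p x -> node_valid p y -> tgt x = tgt y -> x = y.
Proof.
move=> vx vy eqt; apply: (node_addr_inj wfp vx vy); apply: prefix_anti.
  by rewrite -(emb_prefix He) // eqt prefix_refl.
by rewrite -(emb_prefix He) // eqt prefix_refl.
Qed.

Lemma root_valid : node_valid p (inl (root p)).
Proof. exact: root_lt. Qed.

Lemma target_nonroot x : node_valid p x -> x <> inl (root p) -> tgt x <> inl (root q).
Proof.
move=> vx xnr tx; apply: xnr; apply: target_inj => //; first exact: root_valid.
by rewrite tx /= (emb_root He).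
Qed.

Lemma infib_unique l l' w : infib l w -> infib l' w -> l = l'.
Proof.
move=> /infibP[ltl pre H] /infibP[ltl' pre' H'].
by apply: (addr_inj wfp ltl ltl'); apply: prefix_anti; [exact: H' | exact: H].
Qed.

Lemma infib_rho l : l < nv p -> infib l (rho l).
Proof.
move=> ltl; apply/infibP; split=> // [|l' ltl']; first exact: prefix_refl.
by rewrite (emb_prefix He (x := inl l') (y := inl l)).
Qed.

(** A vertex outside the image of [rho] lies in the fibre of its parent, and the root lies in the
    image. *)
Lemma infib_exists w : w < nv q -> exists l, infib l w.
Proof.
move: w; apply: (tree_ind wfq) => w ltw IH.
case pw : (par q w) => [[j k]|]; last first.
  by exists (root p); rewrite (root_unique wfq ltw pw) -(emb_root He); exact/infib_rho/root_lt.
have [l /infibP[ltl pre H]] := IH _ _ pw; have [_ _ ltj] := par_wf wfq pw.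
have [/existsP[l1 /eqP <-]|nex] := boolP [exists l1 : 'I_(nv p), rho l1 == w].
  by exists l1; exact: infib_rho.
exists l; apply/infibP; rewrite (addr_child wfq pw); split=> //.
  exact: prefix_trans pre (prefix_rcons _ _).
move=> l' ltl'; rewrite prefix_rcons_r => /orP[/eqP|]; last exact: H.
rewrite -(addr_child wfq pw) => /(addr_inj wfq (emb_lt He ltl') ltw) rw.
by case/existsP: nex; exists (Ordinal ltl'); rewrite /= rw.
Qed.

Lemma infib_parent l w j k : infib l w -> w < nv q -> w <> rho l -> par q w = Some (j, k) -> infib l j.
Proof.
move=> /infibP[ltl pre H] ltw ne pw; have [_ _ ltj] := par_wf wfq pw.
apply/infibP; split=> //.
  move: pre; rewrite (addr_child wfq pw) prefix_rcons_r => /orP[/eqP|//].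
  rewrite -(addr_child wfq pw) => /(addr_inj wfq (emb_lt He ltl) ltw) rw.
  by rewrite rw in ne.
move=> l' ltl' pre'; apply: H => //; rewrite (addr_child wfq pw).
exact: prefix_trans pre' (prefix_rcons _ _).
Qed.

Lemma fib_connected l : l < nv p -> connected q (fib l) (rho l).
Proof.
move=> ltl; split.
- exact: fib_uniq.
- by move=> w; rewrite mem_fib => /andP[].
- by rewrite mem_fib (emb_lt He) //; exact: infib_rho.
- move=> j k pr; rewrite mem_fib; apply/negP => /andP[_ /infibP[_ pre _]].
  by have := size_prefix pre; rewrite (addr_child wfq pr) size_rcons ltnn.
- move=> w; rewrite mem_fib => /andP[ltw inw] ne.
  case pw : (par q w) => [[j k]|]; last first.
    case: ne; have /infibP[_ + _] := inw.
    rewrite (root_unique wfq ltw pw) addr_root // prefixs0 => /eqP a0.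
    by apply: (addr_inj wfq); rewrite ?root_lt ?(emb_lt He) // a0 addr_root.
  exists j, k; split=> //; rewrite mem_fib.
  by have [_ _ ->] := par_wf wfq pw; exact: infib_parent pw.
Qed.

(* The half-edge of [q] that the half-edge [(l, k)] of [p] is glued to. *)
Definition tslot (l k : nat) : nat * nat := slot_of q (tgt (node_at p (l, k))).

Lemma node_at_nonroot h : slot p h -> node_at p h <> inl (root p).
Proof.
move=> sh E; have := node_at_addr wfp sh.
by rewrite E /= addr_root // /haddr; case: (vaddr p _ _).
Qed.

Lemma tslotP l k : slot p (l, k) ->
  slot q (tslot l k) /\ haddr q (tslot l k) = node_addr q (tgt (node_at p (l, k))).
Proof.
move=> s; apply: slot_ofP => //; first exact/target_valid/node_at_valid.
by apply: target_nonroot; [exact: node_at_valid | exact: node_at_nonroot].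
Qed.

(** The image vertices above or at the vertex [(tslot l k).1] are those strictly above the image of
    the node at [(l, k)], and the strict ancestors of that node are [l] and the ancestors of [l]. *)
Lemma tslot_infib l k : slot p (l, k) -> infib l (tslot l k).1.
Proof.
move=> s; have [st et] := tslotP s; have vx := node_at_valid wfp s.
have ex := node_at_addr wfp s; have /andP[/= ltl _] := s.
move: st et; case: (tslot l k) => w i /= swi et.
have ltw : w < nv q by case/andP: swi.
have pre_w l' : l' < nv p -> prefix (addr q (rho l')) (addr q w) -> prefix (addr p l') (addr p l).
  move=> ltl' pre.
  have : prefix (addr q (rho l')) (node_addr q (tgt (node_at p (l, k)))).
    by rewrite -et; exact: prefix_trans pre (prefix_rcons _ _).
  rewrite (emb_prefix He (x := inl l')) // ex prefix_rcons_r => /orP[/eqP eqa|//].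
  have := emb_prefix He (x := node_at p (l, k)) (y := inl l') vx ltl'.
  rewrite ex /= -[haddr p _]eqa prefix_refl -et => pre'.
  by have := size_prefix (prefix_trans pre' pre); rewrite size_rcons ltnn.
apply/infibP; split=> //.
have : prefix (addr q (rho l)) (haddr q (w, i)).
  by rewrite et (emb_prefix He (x := inl l)) // ex prefix_rcons.
rewrite prefix_rcons_r => /orP[/eqP eqa|//].
have := emb_prefix He (x := node_at p (l, k)) (y := inl l) vx ltl.
rewrite /= -et -[haddr q _]eqa prefix_refl ex => /esym/size_prefix; by rewrite size_rcons ltnn.
Qed.

Lemma tslot_dvg l k k' : slot p (l, k) -> slot p (l, k') -> k < k' ->
  dvg (haddr q (tslot l k)) (haddr q (tslot l k')).
Proof.
move=> s s' lt; have [_ ->] := tslotP s; have [_ ->] := tslotP s'.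
rewrite (emb_dvg He) ?node_at_valid // !node_at_addr //.
by rewrite /haddr /= dvg_rcons_same.
Qed.

Lemma tslot_parent l j k : par p l = Some (j, k) -> par q (rho l) = Some (tslot j k).
Proof.
move=> pl; have [ltl s _] := par_wf wfp pl.
rewrite /tslot (node_at_child wfp pl) /=.
case pr : (par q (rho l)) => [h|] //.
have := @target_nonroot (inl l) ltl; case=> [[lE]|].
  by move: pl; rewrite lE par_root.
by rewrite /= (root_unique wfq (emb_lt He ltl) pr).
Qed.

Lemma tslot_leaf k : 0 < k < nleaves p -> tslot (leaf p k).1 (leaf p k).2 = leaf q k.
Proof.
move=> ltk; rewrite /tslot -surjective_pairing.
by rewrite (@node_atE _ wfp (inr k) (leaf p k)) //; exact: leaf_slot.
Qed.

(** A vertex attached at [tslot l k] is the image of the node at [(l, k)], hence heads another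
    fibre. *)
Lemma tslot_outer l k w : slot p (l, k) -> w \in fib l -> par q w <> Some (tslot l k).
Proof.
move=> s; rewrite mem_fib => /andP[ltw inw] pw.
have [_ et] := tslotP s.
move: pw et; case: (tslot l k) => j i pw et.
have vx := node_at_valid wfp s.
have tE : inl w = tgt (node_at p (l, k)).
  apply: (node_addr_inj wfq) => //; first exact: target_valid.
  by rewrite -et /= (addr_child wfq pw).
case nE : (node_at p (l, k)) tE => [l'|k'] //= -[wE].
have ltl' : l' < nv p by rewrite nE in vx.
have ll' : l = l' by apply: (infib_unique inw); rewrite wE; exact: infib_rho.
have := node_at_addr wfp s; rewrite nE /= -ll' => /(congr1 size).
by rewrite size_rcons => /eqP; rewrite ltn_eqF.
Qed.

(** A half-edge where the fibre is cut ends at the head of another fibre or at a leaf of [q]. In the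
    second case [emb_nleaves] supplies a leaf of [p] with the same index. *)
Lemma tslot_surj l w i : w \in fib l -> slot q (w, i) ->
  (forall w', w' \in fib l -> par q w' <> Some (w, i)) ->
  exists2 k, slot p (l, k) & tslot l k = (w, i).
Proof.
rewrite mem_fib => /andP[ltw inw] swi noch.
case nE : (node_at q (w, i)) / (node_atP wfq swi) => [w' ltw' pw'|k ltk lk _].
  have [l' inw'] := infib_exists ltw'; have /infibP[ltl' _ _] := inw'.
  have w'E : w' = rho l'.
    apply/eqP/negP => /negP/eqP ne.
    have := infib_parent inw' ltw' ne pw' => inw2.
    have ll' := infib_unique inw inw2.
    by apply: (noch w'); rewrite // mem_fib ltw' ll'.
  case pl' : (par p l') => [[j k]|]; last first.
    move: pw'; rewrite w'E (root_unique wfp ltl' pl') (emb_root He).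
    by rewrite par_root.
  have [_ s _] := par_wf wfp pl'.
  have := tslot_parent pl'; rewrite -w'E pw' => -[tE].
  have := tslot_infib s; rewrite -tE /= => inw2.
  by exists k; rewrite (infib_unique inw inw2).
have ltkp : 0 < k < nleaves p by rewrite (emb_nleaves He).
have s := leaf_slot ltkp; have tE := tslot_leaf ltkp.
rewrite lk in tE; case: (leaf p k) s tE => l' k' s tE /=.
have := tslot_infib s; rewrite tE /= => inw2.
by exists k'; rewrite (infib_unique inw inw2).
Qed.

Lemma fib_tree_wf l : l < nv p -> tree_wf (sub q (fib l)).
Proof. by move=> ltl; apply: sub_wf wfq (fib_connected ltl). Qed.

Lemma fib_tree_leaves l : l < nv p -> nleaves (sub q (fib l)) = (ar p l).+1 /\
  forall k, 0 < k <= ar p l ->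
    leaf (sub q (fib l)) k = (index (tslot l k).1 (fib l), (tslot l k).2).
Proof.
move=> ltl; have conn := fib_connected ltl; have wfQ := fib_tree_wf ltl.
have uF := fib_uniq p q rho l.
have sl k : 0 < k <= ar p l -> slot p (l, k) by rewrite /slot /= ltl.
have tin k : 0 < k <= ar p l -> (tslot l k).1 \in fib l.
  move=> lek; have [/andP[ltt _] _] := tslotP (sl _ lek).
  by rewrite mem_fib ltt tslot_infib //; exact: sl.
apply: leaves_unique => //.
- move=> k lek; have [st _] := tslotP (sl _ lek).
  rewrite (mem_nonroot_leaves_sub wfq conn) ?index_mem ?tin // nth_index ?tin //.
  rewrite -surjective_pairing st; apply/hasPn => w inw; apply/eqP.
  by apply: tslot_outer inw; exact: sl.
- move=> k k' k0 lt lek'; have lek : 0 < k <= ar p l by rewrite k0 (leq_trans (ltnW lt)).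
  have lek0 : 0 < k' <= ar p l by rewrite (ltn_trans k0 lt).
  rewrite -(dvg_cat2l (addr q (rho l))) -!(haddr_sub _ conn) ?index_mem ?tin //.
  rewrite !nth_index ?tin // -!surjective_pairing; apply: tslot_dvg => //; exact: sl.
- move=> [u i] uin.
  have ltu : u < size (fib l).
    by move: uin; rewrite mem_nonroot_leaves /slot /= nv_sub => /andP[/andP[]].
  move: uin; rewrite (mem_nonroot_leaves_sub wfq conn) // => /andP[su /hasPn noch].
  have [|k sk tE] := tslot_surj (mem_nth 0 ltu) su.
    by move=> w inw /eqP; apply/negP; exact: noch.
  by exists k; [case/andP: sk | rewrite tE /= index_uniq].
Qed.

Lemma perm_flatten_fibs : perm_eq (flatten (fibs p q rho)) (iota 0 (nv q)).
Proof.
apply: uniq_perm; [|exact: iota_uniq|].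
  rewrite /fibs; elim: (iota 0 (nv p)) (iota_uniq 0 (nv p)) => //= l s IH /andP[nl us].
  rewrite cat_uniq fib_uniq IH // andbT /=; apply/hasPn => w.
  case/flattenP => _ /mapP[l' l's ->]; rewrite !mem_fib => /andP[_ inw'].
  apply/negP => /andP[_ inw]; move: nl; by rewrite (infib_unique inw inw') l's.
move=> w; rewrite mem_iota /= add0n; apply/flattenP/idP => [[_ /mapP[l _ ->]]|ltw].
  by rewrite mem_fib => /andP[].
have [l inw] := infib_exists ltw; have /infibP[ltl _ _] := inw.
by exists (fib l); rewrite ?mem_fib ?ltw //; apply: map_f; rewrite mem_iota.
Qed.

Lemma size_ftrees : size (ftrees p q rho) = nv p.
Proof. by rewrite size_map size_iota. Qed.

Lemma nth_ftrees l : l < nv p -> nth (corolla 0) (ftrees p q rho) l = sub q (fib l).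
Proof. by move=> ltl; rewrite (nth_map 0) ?size_iota // nth_iota. Qed.

Lemma nth_fibs l : l < nv p -> nth [::] (fibs p q rho) l = fib l.
Proof. by move=> ltl; rewrite (nth_map 0) ?size_iota // nth_iota. Qed.

Lemma nth_index_tslot l k : slot p (l, k) ->
  nth 0 (fib l) (index (tslot l k).1 (fib l)) = (tslot l k).1.
Proof.
move=> s; have [/andP[ltt _] _] := tslotP s.
by rewrite nth_index // mem_fib ltt tslot_infib.
Qed.

Lemma embedding_subst : is_subst p q (ftrees p q rho) (fibs p q rho).
Proof.
apply/and5P; split; rewrite ?size_map ?size_iota //.
- apply/allP => l; rewrite mem_iota /= add0n => ltl.
  rewrite nth_ftrees // nth_fibs // nv_sub eqxx fib_sorted.
  by have [-> _] := fib_tree_leaves ltl; rewrite eqxx.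
- exact: perm_flatten_fibs.
apply/andP; split.
  apply/allP => l; rewrite mem_iota /= add0n => ltl.
  rewrite nth_ftrees // nth_fibs //; have conn := fib_connected ltl.
  apply/allP => u; rewrite mem_iota /= add0n nv_sub => ltu.
  rewrite ar_sub // eqxx /=.
  have [uE|/eqP une] := eqVneq u (index (rho l) (fib l)); last first.
    by have [j [k [-> -> jF]]] := par_sub_nonroot conn ltu une; rewrite nth_index.
  have rF : rho l \in fib l by case: conn.
  rewrite uE (par_sub_root conn) nth_index //.
  case pl : (par p l) => [[j k]|]; last first.
    by rewrite (root_unique wfp ltl pl) (emb_root He) par_root.
  have [_ s ltj] := par_wf wfp pl; have [_ lf] := fib_tree_leaves ltj.
  rewrite nth_ftrees // nth_fibs // lf; last by case/andP: s.
  by rewrite nth_index_tslot //= (tslot_parent pl) -surjective_pairing.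
apply/allP => -[|k]; rewrite mem_iota /= add0n => ltk.
  have ltr := root_lt wfp.
  rewrite nth_ftrees // nth_fibs // !leaf0 (root_sub wfq (fib_connected ltr)) /=.
  by rewrite nth_index ?(emb_root He) //; rewrite -(emb_root He); case: (fib_connected ltr).
have ltk' : 0 < k.+1 < nleaves p by [].
have s := leaf_slot ltk'; have tE := tslot_leaf ltk'.
case: (leaf p k.+1) s tE => l i /= s tE; have /andP[/= ltl lei] := s.
have [_ lf] := fib_tree_leaves ltl.
by rewrite nth_ftrees // nth_fibs // lf //= nth_index_tslot // -surjective_pairing tE.
Qed.
End Embedding.

(** * From substitutions to embeddings *)

(** The five relative positions of two addresses exclude one another, so preserving them reflects
    them. Strict prefixes must keep distinct images for this to work. *)
Lemma embedding_intro (p q : rawtree) (rho : nat -> nat) :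
  tree_wf p ->
  (forall v, v < nv p -> rho v < nv q) -> rho (root p) = root q -> nleaves p = nleaves q ->
  (forall x y, node_valid p x -> node_valid p y -> x <> y ->
     prefix (node_addr p x) (node_addr p y) ->
     prefix (node_addr q (target rho x)) (node_addr q (target rho y)) /\
     node_addr q (target rho x) <> node_addr q (target rho y)) ->
  (forall x y, node_valid p x -> node_valid p y -> dvg (node_addr p x) (node_addr p y) ->
     dvg (node_addr q (target rho x)) (node_addr q (target rho y))) ->
  embedding p q rho.
Proof.
move=> wfp rlt rr nl pre div; split=> // x y vx vy.
- case: (addressP (node_addr p x) (node_addr p y)) => [/(node_addr_inj wfp vx vy) ->|pxy ne|pyx ne|d|d].
  + exact: prefix_refl.
  + by have [|->] := pre x y vx vy _ pxy => // xy; apply: ne; rewrite xy.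
  + have [|pt ne'] := pre y x vy vx _ pyx; first by move=> yx; apply: ne; rewrite yx.
    by apply/negP => pt'; apply: ne'; exact: prefix_anti.
  + exact: dvg_nprefix (div _ _ vx vy d).
  + exact: dvg_nprefixr (div _ _ vy vx d).
- case: (addressP (node_addr p x) (node_addr p y)) => [/(node_addr_inj wfp vx vy) ->|pxy ne|pyx ne|d|d].
  + exact: dvg_irr.
  + have [|pt _] := pre x y vx vy _ pxy; first by move=> xy; apply: ne; rewrite xy.
    by apply/negP => d; rewrite (dvg_nprefix d) in pt.
  + have [|pt _] := pre y x vy vx _ pyx; first by move=> yx; apply: ne; rewrite yx.
    by apply/negP => d; rewrite (dvg_nprefixr d) in pt.
  + exact: div.
  + exact: dvg_asym (div _ _ vy vx d).
Qed.

Lemma uniq_flatten_nth (ss : seq (seq nat)) i j w : uniq (flatten ss) ->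
  w \in nth [::] ss i -> w \in nth [::] ss j -> i = j.
Proof.
have in_flatten (tt : seq (seq nat)) k : w \in nth [::] tt k -> w \in flatten tt.
  move=> wk; apply/flattenP; exists (nth [::] tt k) => //; apply: mem_nth.
  by rewrite ltnNge; apply/negP => ge; rewrite nth_default in wk.
elim: ss i j => [|s ss IH] [|i] [|j] //=; rewrite cat_uniq => /and3P[_ /hasPn dis uss].
- by move=> ws /in_flatten/dis; rewrite /= ws.
- by move=> /in_flatten/dis + ws; rewrite /= ws.
- by move=> wi wj; rewrite (IH _ _ uss wi wj).
Qed.

Lemma par_neq t (wf : tree_wf t) v j k : par t v = Some (j, k) -> v <> j.
Proof.
by move=> pv vj; have := congr1 size (addr_child wf pv); rewrite vj size_rcons => /eqP; rewrite ltn_eqF.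
Qed.

Section Substitution.
Variables (p q : rawtree) (qs : seq rawtree) (sg : seq (seq nat)).
Hypotheses (wfp : tree_wf p) (wfq : tree_wf q) (wfqs : all tree_wf qs).
Hypothesis Hs : is_subst p q qs sg.

Local Notation Q l := (nth (corolla 0) qs l).
Local Notation S l := (nth [::] sg l).
Local Notation img l u := (nth 0 (nth [::] sg l) u).

Definition subst_root (l : nat) : nat := img l (root (Q l)).
Local Notation rho := subst_root.
Local Notation ndt x := (node_addr q (target rho x)).

Lemma subst_size : size qs = nv p /\ size sg = nv p.
Proof. by case/and5P: Hs => /eqP-> /eqP->. Qed.

Lemma wfQ l : l < nv p -> tree_wf (Q l).
Proof. by move=> ltl; apply: (allP wfqs); rewrite mem_nth // (proj1 subst_size). Qed.

Lemma subst_fiber l : l < nv p ->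
  [/\ size (S l) = nv (Q l), sorted ltn (S l) & nleaves (Q l) = (ar p l).+1].
Proof.
move=> ltl; case/and5P: Hs => _ _ /allP /(_ l) + _ _; rewrite mem_iota ltl.
by move=> /(_ isT) /and3P[/eqP ? ? /eqP ?].
Qed.

Lemma S_uniq l : l < nv p -> uniq (S l).
Proof.
by case/subst_fiber=> _ srt _; apply: sorted_uniq srt; [exact: ltn_trans | exact: ltnn].
Qed.

Lemma img_in l u : l < nv p -> u < nv (Q l) -> img l u \in S l.
Proof. by move=> ltl ltu; have [sz _ _] := subst_fiber ltl; rewrite mem_nth ?sz. Qed.

Lemma S_lt l w : w \in S l -> w < nv q.
Proof.
case/and5P: Hs => _ _ _ pm _ wS.
have : w \in flatten sg.
  apply/flattenP; exists (S l) => //; apply: mem_nth.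
  by rewrite ltnNge; apply/negP => ge; rewrite nth_default in wS.
by rewrite (perm_mem pm) mem_iota.
Qed.

Lemma S_cover w : w < nv q -> exists2 l, l < nv p & w \in S l.
Proof.
move=> ltw; case/and5P: Hs => _ /eqP sz _ pm _.
have : w \in flatten sg by rewrite (perm_mem pm) mem_iota.
case/flattenP => s /(nthP [::])[l ltl <-] ws; exists l => //; by rewrite -sz.
Qed.

Lemma S_disjoint l l' w : w \in S l -> w \in S l' -> l = l'.
Proof.
apply: uniq_flatten_nth; case/and5P: Hs => _ _ _ pm _.
by rewrite (perm_uniq pm) iota_uniq.
Qed.

Definition glue (l k : nat) : nat * nat :=
  (img l (leaf (Q l) k).1, (leaf (Q l) k).2).

Lemma subst_ar l u : l < nv p -> u < nv (Q l) -> ar q (img l u) = ar (Q l) u.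
Proof.
move=> ltl ltu; case/and5P: Hs => _ _ _ _ /andP[/allP /(_ l) + _].
rewrite mem_iota ltl => /(_ isT) /allP /(_ u); rewrite mem_iota ltu.
by move=> /(_ isT) /andP[/eqP].
Qed.

Lemma subst_par l u : l < nv p -> u < nv (Q l) -> par q (img l u) =
  match par (Q l) u with
  | Some (u', k) => Some (img l u', k)
  | None => if par p l is Some (j, k) then Some (glue j k) else None
  end.
Proof.
move=> ltl ltu; case/and5P: Hs => _ _ _ _ /andP[/allP /(_ l) + _].
rewrite mem_iota ltl => /(_ isT) /allP /(_ u); rewrite mem_iota ltu.
by move=> /(_ isT) /andP[_ /eqP].
Qed.

Lemma subst_leaf k : k < nleaves p -> leaf q k = glue (leaf p k).1 (leaf p k).2.
Proof.
move=> ltk; case/and5P: Hs => _ _ _ _ /andP[_ /allP /(_ k)].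
by rewrite mem_iota ltk => /(_ isT) /eqP.
Qed.

Lemma rho_lt l : l < nv p -> rho l < nv q.
Proof. by move=> ltl; apply: (@S_lt l); apply: img_in => //; exact/root_lt/wfQ. Qed.

Lemma par_rho l : l < nv p ->
  par q (rho l) = if par p l is Some (j, k) then Some (glue j k) else None.
Proof.
move=> ltl; have wfl := wfQ ltl.
by rewrite subst_par ?par_root //; exact: root_lt.
Qed.

Lemma rho_root : rho (root p) = root q.
Proof.
have ltr := root_lt wfp; apply: (root_unique wfq); first exact: rho_lt.
by rewrite par_rho // par_root.
Qed.

Lemma addr_img l u : l < nv p -> u < nv (Q l) ->
  addr q (img l u) = addr q (rho l) ++ addr (Q l) u.
Proof.
move=> ltl; have wfl := wfQ ltl; move: u; apply: (tree_ind wfl) => u ltu IH.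
case pu : (par (Q l) u) => [[j k]|].
  have pq : par q (img l u) = Some (img l j, k) by rewrite subst_par // pu.
  by rewrite (addr_child wfq pq) (addr_child wfl pu) -rcons_cat -(IH _ _ pu).
by rewrite (root_unique wfl ltu pu) addr_root // cats0.
Qed.

Lemma slot_fiber_leaf l k : slot p (l, k) -> 0 < k < nleaves (Q l).
Proof. by case/andP=> /= ltl lek; have [_ _ ->] := subst_fiber ltl. Qed.

Lemma haddr_glue l k : slot p (l, k) ->
  haddr q (glue l k) = addr q (rho l) ++ haddr (Q l) (leaf (Q l) k).
Proof.
move=> s; have /andP[/= ltl _] := s.
have /andP[ltu _] := leaf_slot (slot_fiber_leaf s).
by rewrite /glue {1}/haddr /= addr_img // -rcons_cat.
Qed.

Lemma ndt_glue x : node_valid p x -> x <> inl (root p) ->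
  ndt x = haddr q (glue (slot_of p x).1 (slot_of p x).2).
Proof.
case: x => [v|k] /= vx xnr; last by case/andP: vx => _ /subst_leaf <-.
case pv : (par p v) => [[j k]|]; last by case: xnr; rewrite (root_unique wfp vx pv).
have : par q (rho v) = Some (glue j k) by rewrite par_rho // pv.
by case: (glue j k) => w i /(addr_child wfq).
Qed.

Lemma ndt_slot x : node_valid p x -> x <> inl (root p) ->
  exists l k, [/\ slot p (l, k), node_addr p x = rcons (addr p l) k &
    ndt x = addr q (rho l) ++ haddr (Q l) (leaf (Q l) k)].
Proof.
move=> vx xnr; have [sx ex] := slot_ofP wfp vx xnr.
have := ndt_glue vx xnr; rewrite -ex; case: (slot_of p x) sx {ex} => l k s /= ->.
by exists l, k; rewrite haddr_glue.
Qed.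

(** Stepping in [p] from [l] to the node at [(l, k)] means, in [q], crossing [Q l] from its root to
    its leaf [k], which strictly lengthens the address. [n] bounds the induction on depth. *)
Lemma ndt_prefix n x y : size (node_addr p y) < n -> node_valid p x -> node_valid p y ->
  x <> y -> prefix (node_addr p x) (node_addr p y) ->
  prefix (ndt x) (ndt y) /\ size (ndt x) < size (ndt y).
Proof.
elim: n x y => // n IH x y szy vx vy ne pre.
case: (eqVneq y (inl (root p))) => [yr|/eqP ynr].
  move: pre; rewrite yr /= addr_root // prefixs0 => /eqP a0; case: ne.
  by apply: (node_addr_inj wfp); rewrite // yr a0 /= addr_root.
have [l [k [s ey ty]]] := ndt_slot vy ynr; have /andP[/= ltl _] := s.
have ltt : size (ndt (inl l)) < size (ndt y).
  by rewrite ty size_cat /haddr size_rcons addnS ltnS leq_addr.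
have ptl : prefix (ndt (inl l)) (ndt y) by rewrite ty prefix_prefix.
move: pre; rewrite ey prefix_rcons_r -ey => /orP[/eqP/(node_addr_inj wfp vx vy)//|pre].
case: (eqVneq x (inl l)) => [-> //|/eqP xl].
have [|pt lt] := IH x (inl l) _ vx ltl xl pre.
  by rewrite ey size_rcons in szy.
by split; [exact: prefix_trans pt ptl | exact: ltn_trans lt ltt].
Qed.

(** Nodes at one vertex [l] are separated by the planar order of the leaves of [Q l]. Otherwise a
    parent already diverges, and [dvg] passes to extensions. *)
Lemma ndt_dvg n x y : size (node_addr p x) + size (node_addr p y) < n ->
  node_valid p x -> node_valid p y ->
  dvg (node_addr p x) (node_addr p y) -> dvg (ndt x) (ndt y).
Proof.
elim: n x y => // n IH x y sz vx vy.
case: (eqVneq x (inl (root p))) => [->|/eqP xnr]; first by rewrite /= addr_root.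
case: (eqVneq y (inl (root p))) => [->|/eqP ynr].
  by rewrite /= addr_root //; case: (node_addr p x).
have [l [k [sx ex tx]]] := ndt_slot vx xnr; have /andP[/= ltl _] := sx.
have [j [i [sy ey ty]]] := ndt_slot vy ynr; have /andP[/= ltj _] := sy.
move: sz; rewrite ex ey !size_rcons addSn addnS ltnS => sz.
case/dvg_rcons=> [[eqa ltki]|d|d].
- have lj := addr_inj wfp ltl ltj eqa; subst j.
  rewrite tx ty dvg_cat2l; apply: leaf_dvg => //; first exact: wfQ.
    by case/andP: (slot_fiber_leaf sx).
  by case/andP: (slot_fiber_leaf sy).
- have : dvg (ndt (inl l)) (ndt y).
    by apply: IH => //; rewrite ?ey // size_rcons addnS.
  by move/dvg_prefix; apply; rewrite ?prefix_refl // tx prefix_prefix.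
- have : dvg (ndt x) (ndt (inl j)).
    by apply: IH => //; rewrite ?ex // size_rcons addSn.
  by move/dvg_prefix; apply; rewrite ?prefix_refl // ty prefix_prefix.
Qed.

Lemma glue_pos l k : slot p (l, k) -> 0 < (glue l k).2.
Proof. by move=> s; case/andP: (leaf_slot (slot_fiber_leaf s)) => _ /andP[]. Qed.

Lemma leaf_inj t (wf : tree_wf t) k k' : 0 < k < nleaves t -> 0 < k' < nleaves t ->
  leaf t k = leaf t k' -> k = k'.
Proof.
move=> /andP[k0 ltk] /andP[k0' ltk'] eql; case: (ltngtP k k') => // lt.
  by have := leaf_dvg wf k0 lt ltk'; rewrite eql dvg_irr.
by have := leaf_dvg wf k0' lt ltk; rewrite eql dvg_irr.
Qed.

(** [is_subst] prescribes [leaf q k] only for [k < nleaves p], so both inequalities need an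
    argument. *)
Lemma subst_nleaves : nleaves p = nleaves q.
Proof.
apply/eqP; rewrite eqn_leq; apply/andP; split.
  (* A missing leaf of [q] would read as the default [(0, 0)], but glued half-edges have positive
     second component. *)
  rewrite leqNgt; apply/negP => lt.
  have ltk : 0 < nleaves q < nleaves p by rewrite lt nleavesE.
  have s := leaf_slot ltk; have := subst_leaf lt.
  rewrite /leaf nth_default // -/(leaf p _); case: (leaf p _) s => l k s E.
  by have := glue_pos s; rewrite -E.
(* A surplus leaf of [q] is leaf [k] of some [Q l]. The half-edge [(l, k)] of [p] then carries an
   edge, so that a vertex hangs there in [q], or a leaf of [p], which is glued to a leaf of [q] of
   smaller index. *)
rewrite leqNgt; apply/negP => lt.
have ltk : 0 < nleaves p < nleaves q by rewrite lt nleavesE.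
have := leaf_mem ltk; case E : (leaf q (nleaves p)) => [w i].
rewrite mem_nonroot_leaves => /andP[/andP[/= ltw lei] noch].
have [l ltl /(nthP 0)[u]] := S_cover ltw; have [sz _ _] := subst_fiber ltl.
rewrite sz => ltu uE.
have lin : (u, i) \in nonroot_leaves (Q l).
  rewrite mem_nonroot_leaves /slot /= ltu -subst_ar // uE lei.
  apply/negP => /(par_mem (wfQ ltl))[u' ltu' pu']; case/negP: noch.
  apply/(par_mem wfq); exists (img l u'); first exact/S_lt/img_in.
  by rewrite subst_par // pu' uE.
have [ltk' kE] := leaf_index lin; move: (index _ _) ltk' kE => k ltk' kE.
have gE : glue l k = (w, i) by rewrite /glue kE /= uE.
have s : slot p (l, k).
  by have [_ _ nE] := subst_fiber ltl; rewrite nE in ltk'; rewrite /slot /= ltl.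
case: (node_atP wfp s) => [v ltv pv|k' ltk2 lk _].
  case/negP: noch; apply/(par_mem wfq); exists (rho v); first exact: rho_lt.
  by rewrite par_rho // pv gE.
have ltk2' : 0 < k' < nleaves q by case/andP: ltk2 => -> /ltn_trans; apply.
have /andP[_ ltk2p] := ltk2.
have := subst_leaf ltk2p; rewrite lk /= gE -E => /(leaf_inj wfq ltk2' ltk) kk.
by rewrite kk ltnn in ltk2p.
Qed.

Lemma subst_embedding : embedding p q rho.
Proof.
apply: (embedding_intro wfp rho_lt rho_root subst_nleaves) => x y vx vy.
  move=> ne pre; have [pt lt] := ndt_prefix (ltnSn _) vx vy ne pre.
  by split=> // eqt; rewrite eqt ltnn in lt.
exact: ndt_dvg (ltnSn _) vx vy.
Qed.

(** If [rho l'] lies above [img l u], then [l] and [l'] do not diverge. Were [l'] strictly below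
    [l], the path to [img l u] would leave [Q l] through a leaf, although it ends in a vertex of
    [Q l]. *)
Lemma infib_img l u : l < nv p -> u < nv (Q l) -> infib p q rho l (img l u).
Proof.
move=> ltl ltu; have He := subst_embedding; apply/infibP; split=> //.
  by rewrite addr_img // prefix_prefix.
move=> l' ltl' pre.
have := emb_dvg He (x := inl l') (y := inl l) ltl' ltl.
have := emb_dvg He (x := inl l) (y := inl l') ltl ltl'.
have ndvg s s' : prefix s (addr q (img l u)) -> prefix s' (addr q (img l u)) -> dvg s s' = false.
  by move=> ps ps'; apply/negP => /dvg_prefix /(_ ps ps'); rewrite dvg_irr.
have prl : prefix (addr q (rho l)) (addr q (img l u)) by rewrite addr_img // prefix_prefix.
rewrite /= (ndvg _ _ pre prl) (ndvg _ _ prl pre).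
case: (addressP (addr p l') (addr p l)) => // pll ne _ _.
have [k prek] := prefix_next pll (nesym ne).
have s : slot p (l, k) by apply: (@prefix_slot _ wfp l k (inl l')).
have vx := node_at_valid wfp s.
have xnr : node_at p (l, k) <> inl (root p) by exact: node_at_nonroot.
have sE := slot_of_node_at wfp s.
have tE := ndt_glue vx xnr; rewrite sE /= haddr_glue // in tE.
have : prefix (ndt (node_at p (l, k))) (addr q (img l u)).
  apply: prefix_trans pre; rewrite (emb_prefix He (y := inl l')) //.
  by rewrite node_at_addr.
rewrite tE addr_img // prefix_cat2l => pleaf.
by have := @leaf_node_maximal _ (wfQ ltl) k (inl u) (slot_fiber_leaf s) ltu pleaf.
Qed.

(** One inclusion is enough: the [S l] cover the vertices of [q], and fibres are disjoint. Both
    lists being increasing, they agree as lists. *)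
Lemma subst_fib l : l < nv p -> S l = fib p q rho l.
Proof.
move=> ltl; have [sz srt _] := subst_fiber ltl.
have in_fib l' w : l' < nv p -> w \in S l' -> infib p q rho l' w.
  move=> ltl' /(nthP 0)[u]; have [-> _ _] := subst_fiber ltl' => ltu <-.
  exact: infib_img.
apply: (irr_sorted_eq ltn_trans ltnn srt (fib_sorted _ _ _ _)) => w.
rewrite mem_fib; apply/idP/andP => [wS|[ltw inw]].
  by split; [exact: S_lt wS | exact: in_fib].
have [l' ltl' wS] := S_cover ltw.
by rewrite (infib_unique wfp inw (in_fib _ _ ltl' wS)).
Qed.

Lemma subst_tree l : l < nv p -> Q l = sub q (S l).
Proof.
move=> ltl; have [sz srt _] := subst_fiber ltl.
apply: sub_unique; rewrite ?sz //; first exact: wfQ.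
- exact: S_uniq.
- by move=> u ltu; rewrite subst_ar.
- by move=> u ltu j k pu; rewrite subst_par // pu.
move=> u ltu pu j k; rewrite subst_par // pu.
case pl : (par p l) => [[l' k']|] // [<- _].
have [_ s ltl'] := par_wf wfp pl.
have /andP[ltu' _] := leaf_slot (slot_fiber_leaf s).
by apply/negP => wS; apply: (par_neq wfp pl); exact: S_disjoint wS (img_in ltl' ltu').
Qed.

Lemma subst_eq_fibs : qs = ftrees p q rho /\ sg = fibs p q rho.
Proof.
have [szq szs] := subst_size; split.
  apply: (@eq_from_nth _ (corolla 0)) => [|l]; rewrite szq ?size_ftrees // => ltl.
  by rewrite nth_ftrees // -subst_fib // -subst_tree.
apply: (@eq_from_nth _ [::]) => [|l]; rewrite szs ?size_map ?size_iota // => ltl.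
by rewrite nth_fibs // subst_fib.
Qed.
End Substitution.

(** * The category of embeddings *)

Lemma target_comp f g x : target g (target f x) = target (g \o f) x.
Proof. by case: x. Qed.

Lemma embedding_id p : embedding p p id.
Proof. by split=> // -[v|k] [w|i]. Qed.

Lemma embedding_comp p q r f g : embedding p q f -> embedding q r g -> embedding p r (g \o f).
Proof.
move=> Ef Eg; split.
- by move=> v /(emb_lt Ef)/(emb_lt Eg).
- by rewrite /= (emb_root Ef) (emb_root Eg).
- by rewrite (emb_nleaves Ef) (emb_nleaves Eg).
- move=> x y vx vy; rewrite -!(target_comp f g) (emb_prefix Eg) ?(emb_prefix Ef) //; exact: (target_valid Ef).
- move=> x y vx vy; rewrite -!(target_comp f g) (emb_dvg Eg) ?(emb_dvg Ef) //; exact: (target_valid Ef).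
Qed.

Lemma target_ext p f g x : {in gtn (nv p), f =1 g} -> node_valid p x -> target f x = target g x.
Proof. by case: x => //= v fg ltv; rewrite fg. Qed.

Lemma embedding_ext p q f g : tree_wf p -> {in gtn (nv p), f =1 g} ->
  embedding p q f -> embedding p q g.
Proof.
move=> wfp fg Ef; split.
- by move=> v ltv; rewrite -fg //; exact: emb_lt Ef _ ltv.
- by rewrite -fg ?(emb_root Ef) //; exact: root_lt.
- exact: emb_nleaves Ef.
- by move=> x y vx vy; rewrite -!(target_ext fg) // (emb_prefix Ef).
- by move=> x y vx vy; rewrite -!(target_ext fg) // (emb_dvg Ef).
Qed.

Lemma fib_ext p q f g l : {in gtn (nv p), f =1 g} -> l < nv p -> fib p q f l = fib p q g l.
Proof.
move=> fg ltl; apply: eq_filter => w; rewrite /infib ltl (fg l ltl); congr [&& _, _ & _].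
by apply: eq_in_all => l'; rewrite mem_iota => ltl'; rewrite fg.
Qed.

Lemma index_nth_map (T I : seq nat) j : uniq T -> {in I, forall i, i < size T} -> j \in T ->
  index (index j T) I = index j (map (nth 0 T) I).
Proof.
move=> uT + jT; elim: I => //= i I IH ltI; rewrite IH; last first.
  by move=> x xI; apply: ltI; rewrite inE xI orbT.
have lti : i < size T by apply: ltI; rewrite mem_head.
congr (if _ then _ else _).
by rewrite -{2}(nth_index 0 jT) nth_uniq // index_mem.
Qed.

Lemma sub_sub r (T I : seq nat) : uniq T -> {in I, forall i, i < size T} ->
  sub (sub r T) I = sub r (map (nth 0 T) I).
Proof.
move=> uT ltI; rewrite /sub -!map_comp; congr pair; apply/eq_in_map => i /ltI lti /=.
  by rewrite ar_sub.
rewrite par_sub //; case: (par r _) => [[j k]|//].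
have -> : (j \in map (nth 0 T) I) = (j \in T) && (index j T \in I).
  apply/mapP/andP => [[x xI ->]|[jT jI]]; last by exists (index j T); rewrite // nth_index.
  by rewrite mem_nth ?ltI // index_uniq // ltI.
by case jT : (j \in T) => //=; rewrite index_nth_map.
Qed.

(** * Fibres of a composite embedding *)

Section Composition.
Variables (p q r : rawtree) (f g : nat -> nat) (l : nat).
Hypotheses (wfp : tree_wf p) (wfq : tree_wf q) (wfr : tree_wf r).
Hypotheses (Ef : embedding p q f) (Eg : embedding q r g) (ltl : l < nv p).

Let S := fib p q f l.
Let T := fib p r (g \o f) l.
Let Q := sub q S.
Let H := sub r T.
Let Egf := embedding_comp Ef Eg.
Let connS : connected q S (f l) := fib_connected wfq Ef ltl.
Let connT : connected r T (g (f l)) := fib_connected wfr Egf ltl.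

(** The restriction of [g] to the fibres over [l], in the vertex numberings of the trees [Q] and
    [H]. *)
Definition fiber_map (u : nat) : nat := index (g (nth 0 S u)) T.
Local Notation rho := fiber_map.

Lemma infib_comp l' w x : infib p q f l' w -> infib q r g w x -> infib p r (g \o f) l' x.
Proof.
move=> /infibP[ltl' pre Hl] /infibP[ltw prex Hw]; apply/infibP; split=> //.
  by apply: prefix_trans prex; rewrite (emb_prefix Eg (x := inl (f l')) (y := inl w)) //; exact: emb_lt Ef _ ltl'.
by move=> m ltm prem; apply: Hl => //; apply: Hw => //; exact: emb_lt Ef _ ltm.
Qed.

Lemma fiber_factor x : x \in T -> exists2 u, u < size S & infib q r g (nth 0 S u) x.
Proof.
rewrite mem_fib => /andP[ltx inx].
have [w inw] := infib_exists wfq wfr Eg ltx; have /infibP[ltw _ _] := inw.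
have [l1 inl1] := infib_exists wfp wfq Ef ltw.
have wS : w \in S by rewrite mem_fib ltw (infib_unique wfp inx (infib_comp inl1 inw)).
by exists (index w S); rewrite ?index_mem // nth_index.
Qed.

Lemma S_infib u : u < size S -> nth 0 S u < nv q /\ infib p q f l (nth 0 S u).
Proof. by move=> /(mem_nth 0); rewrite mem_fib => /andP[]. Qed.

Lemma fiber_comp u x : u < size S -> x < nv r -> infib q r g (nth 0 S u) x -> x \in T.
Proof. by move=> /S_infib[_ inw] ltx inx; rewrite mem_fib ltx; exact: infib_comp inw inx. Qed.

Lemma image_in_T u : u < size S -> g (nth 0 S u) \in T.
Proof.
move=> ltu; have [ltw inw] := S_infib ltu.
by apply: (fiber_comp ltu); [exact: emb_lt Eg _ ltw | exact: infib_rho].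
Qed.

Lemma nth_rho u : u < size S -> nth 0 T (rho u) = g (nth 0 S u).
Proof. by move=> ltu; rewrite nth_index ?image_in_T. Qed.

(** Addresses in a fibre are addresses in the whole tree without a fixed prefix, so relations in [Q]
    and [H] reduce to those in [q] and [r]. Leaf [k] of [Q] is the place where the image of the node
    at [(l, k)] was cut off. *)
Lemma fiber_node y : node_valid Q y -> exists z, [/\ node_valid q z,
  node_addr q z = addr q (f l) ++ node_addr Q y &
  node_addr r (target g z) = addr r (g (f l)) ++ node_addr H (target rho y)].
Proof.
case: y => [u|k] /=.
  move=> ltQ; have ltu : u < size S by rewrite nv_sub in ltQ.
  have [ltw _] := S_infib ltu.
  exists (inl (nth 0 S u)); split=> //=; first exact: (addr_sub wfq connS ltu).
  by rewrite -(nth_rho ltu) (addr_sub wfr connT) // index_mem image_in_T.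
have [nQ lQ] := fib_tree_leaves wfp wfq Ef ltl.
have [_ lH] := fib_tree_leaves wfp wfr Egf ltl.
rewrite nQ ltnS => lek; have s : slot p (l, k) by rewrite /slot /= ltl.
exists (target f (node_at p (l, k))); split.
- exact/(target_valid Ef)/node_at_valid.
- have [_ <-] := tslotP wfp wfq Ef s; have := tslot_infib wfp wfq Ef s.
  have [/andP[ltt _] _] := tslotP wfp wfq Ef s => int.
  have tS : (tslot p q f l k).1 \in S by rewrite mem_fib ltt.
  by rewrite lQ // -(haddr_sub wfq connS) ?index_mem // nth_index.
- rewrite target_comp; have [_ <-] := tslotP wfp wfr Egf s; have := tslot_infib wfp wfr Egf s.
  have [/andP[ltt _] _] := tslotP wfp wfr Egf s => int.
  have tT : (tslot p r (g \o f) l k).1 \in T by rewrite mem_fib ltt.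
  by rewrite lH // -(haddr_sub wfr connT) ?index_mem // nth_index.
Qed.

Lemma fiber_embedding : embedding Q H rho.
Proof.
split.
- by move=> u; rewrite !nv_sub => ltu; rewrite index_mem image_in_T.
- rewrite (root_sub wfq connS) (root_sub wfr connT) /rho nth_index //; by case: connS.
- have [-> _] := fib_tree_leaves wfp wfq Ef ltl.
  by have [-> _] := fib_tree_leaves wfp wfr Egf ltl.
- move=> x y /fiber_node[zx [vx ex tx]] /fiber_node[zy [vy ey ty]].
  rewrite -(prefix_cat2l (addr r (g (f l)))) -tx -ty (emb_prefix Eg) //.
  by rewrite ex ey prefix_cat2l.
- move=> x y /fiber_node[zx [vx ex tx]] /fiber_node[zy [vy ey ty]].
  rewrite -(dvg_cat2l (addr r (g (f l)))) -tx -ty (emb_dvg Eg) //.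
  by rewrite ex ey dvg_cat2l.
Qed.

Lemma fiber_infib u i : u < size S -> i < size T ->
  infib q r g (nth 0 S u) (nth 0 T i) -> infib Q H rho u i.
Proof.
move=> ltu lti /infibP[ltw pre Hw].
have preE u' : u' < size S ->
    prefix (addr H (rho u')) (addr H i) = prefix (addr r (g (nth 0 S u'))) (addr r (nth 0 T i)).
  move=> ltu'; rewrite -(nth_rho ltu') !(addr_sub wfr connT) ?prefix_cat2l //.
  by rewrite index_mem image_in_T.
apply/infibP; rewrite preE //; split=> //; first by rewrite nv_sub.
move=> u' ltQ; have ltu' : u' < size S by rewrite nv_sub in ltQ.
rewrite preE // => pre'.
have [ltw' _] := S_infib ltu'; have := Hw _ ltw' pre'.
by rewrite !(addr_sub wfq connS) // prefix_cat2l.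
Qed.

(** For the inclusion from left to right, each element of [T] lies over some element of [S], which
    disjointness of the fibres of [rho] identifies. *)
Lemma fiber_fib u : u < size S -> map (nth 0 T) (fib Q H rho u) = fib q r g (nth 0 S u).
Proof.
move=> ltu; have wfQ := fib_tree_wf wfq Ef ltl; have wfH := fib_tree_wf wfr Egf ltl.
have ltT i : i \in fib Q H rho u -> i < size T by rewrite mem_fib nv_sub => /andP[].
have uT : uniq T by exact: fib_uniq.
apply: (irr_sorted_eq ltn_trans ltnn _ (fib_sorted _ _ _ _)).
  rewrite sorted_map; apply: (@sub_in_sorted _ [in fib Q H rho u] ltn).
  - move=> i j /ltT lti /ltT ltj lt; apply: (sorted_ltn_nth ltn_trans) => //.
    exact: fib_sorted.
  - exact/allP.
  - exact: fib_sorted.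
move=> x; rewrite mem_fib; apply/mapP/andP => [[i iF ->]|[ltx inx]].
  have lti := ltT _ iF; have iT := mem_nth 0 lti.
  have [u1 ltu1 in1] := fiber_factor iT.
  move: iF; rewrite mem_fib => /andP[_ ini].
  have <- := infib_unique wfQ (fiber_infib ltu1 lti in1) ini.
  by split=> //; move: iT; rewrite mem_fib => /andP[].
have xT := fiber_comp ltu ltx inx.
have ltx' : index x T < size T by rewrite index_mem.
exists (index x T); last by rewrite nth_index.
by rewrite mem_fib nv_sub ltx' fiber_infib // nth_index.
Qed.

Lemma fiber_ftrees :
  ftrees Q H rho = [seq sub r (fib q r g (nth 0 S u)) | u <- iota 0 (nv Q)].
Proof.
apply/eq_in_map => u; rewrite mem_iota /= add0n nv_sub => ltu.
rewrite -fiber_fib // -sub_sub //; first exact: fib_uniq.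
by move=> i; rewrite mem_fib nv_sub => /andP[].
Qed.
End Composition.

(** Being boolean, over lists of length [nv p], it makes morphisms equal as soon as their values on
    vertices are. *)
Definition is_emb (p q : rawtree) (s : seq nat) : bool :=
  [&& size s == nv p, all (gtn (nv q)) s, nth 0 s (root p) == root q, nleaves p == nleaves q &
   all (fun x => all (fun y =>
      (prefix (node_addr q (target (nth 0 s) x)) (node_addr q (target (nth 0 s) y)) ==
       prefix (node_addr p x) (node_addr p y)) &&
      (dvg (node_addr q (target (nth 0 s) x)) (node_addr q (target (nth 0 s) y)) ==
       dvg (node_addr p x) (node_addr p y)))
    (nodes p)) (nodes p)].

Lemma is_embP p q s : reflect (size s = nv p /\ embedding p q (nth 0 s)) (is_emb p q s).
Proof.
apply: (iffP and5P) => [[/eqP sz lt /eqP rr /eqP nl rel]|[sz E]].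
  split=> //; split=> // [v ltv|x y vx vy|x y vx vy].
  - by apply: (allP lt); rewrite mem_nth // sz.
  - move/allP: rel => /(_ x); rewrite mem_nodes => /(_ vx) /allP /(_ y).
    by rewrite mem_nodes => /(_ vy) /andP[/eqP].
  - move/allP: rel => /(_ x); rewrite mem_nodes => /(_ vx) /allP /(_ y).
    by rewrite mem_nodes => /(_ vy) /andP[_ /eqP].
split; try by apply/eqP; rewrite ?sz ?(emb_root E) ?(emb_nleaves E).
  by apply/(all_nthP 0) => i; rewrite sz => /(emb_lt E).
apply/allP => x; rewrite mem_nodes => vx; apply/allP => y; rewrite mem_nodes => vy.
by rewrite (emb_prefix E) // (emb_dvg E) // !eqxx.
Qed.

Definition EmbHom (p q : PTree) : Type := {s : seq nat | is_emb (val p) (val q) s}.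

Definition emb_fun (p q : PTree) (s : EmbHom p q) : nat -> nat := nth 0 (val s).

Lemma emb_size (p q : PTree) (s : EmbHom p q) : size (val s) = nv (val p).
Proof. by case/is_embP: (valP s). Qed.

Lemma emb_embedding (p q : PTree) (s : EmbHom p q) : embedding (val p) (val q) (emb_fun s).
Proof. by case/is_embP: (valP s). Qed.

Lemma emb_id_subproof (p : PTree) : is_emb (val p) (val p) (iota 0 (nv (val p))).
Proof.
apply/is_embP; rewrite size_iota; split=> //.
apply: embedding_ext (embedding_id _); first exact: (valP p).
by move=> v ltv; rewrite nth_iota.
Qed.

Definition emb_id (p : PTree) : EmbHom p p :=
  exist (fun s => is_emb _ _ s) _ (emb_id_subproof p).

Lemma nth_comp (p q : PTree) (g : nat -> nat) (f : EmbHom p q) :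
  {in gtn (nv (val p)), g \o emb_fun f =1 nth 0 (map g (val f))}.
Proof. by move=> v ltv; rewrite (nth_map 0) ?emb_size. Qed.

Lemma emb_comp_subproof (p q r : PTree) (g : EmbHom q r) (f : EmbHom p q) :
  is_emb (val p) (val r) (map (emb_fun g) (val f)).
Proof.
apply/is_embP; rewrite size_map emb_size; split=> //.
apply: embedding_ext (embedding_comp (emb_embedding f) (emb_embedding g)); first exact: (valP p).
exact: nth_comp.
Qed.

Definition emb_comp (p q r : PTree) (g : EmbHom q r) (f : EmbHom p q) : EmbHom p r :=
  exist (fun s => is_emb _ _ s) _ (emb_comp_subproof g f).

Lemma emb_entries (p q : PTree) (f : EmbHom p q) v : v \in val f -> v < nv (val q).
Proof. by case/(nthP 0)=> i; rewrite emb_size => lti <-; exact: emb_lt (emb_embedding f) _ lti. Qed.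

Lemma emb_comp_assoc (a b c d : PTree) (h : EmbHom c d) (g : EmbHom b c) (f : EmbHom a b) :
  emb_comp h (emb_comp g f) = emb_comp (emb_comp h g) f.
Proof.
apply: val_inj => /=; rewrite -map_comp; apply/eq_in_map => v /emb_entries ltv.
by rewrite /emb_fun /= (nth_map 0) ?emb_size.
Qed.

Lemma emb_comp_idl (a b : PTree) (f : EmbHom a b) : emb_comp (emb_id b) f = f.
Proof.
apply: val_inj => /=; rewrite -[RHS]map_id; apply/eq_in_map => v /emb_entries ltv.
by rewrite /emb_fun /= nth_iota.
Qed.

Lemma emb_comp_idr (a b : PTree) (f : EmbHom a b) : emb_comp f (emb_id a) = f.
Proof. by apply: val_inj => /=; rewrite -(emb_size f); exact: mkseq_nth. Qed.

Definition EmbCat : Category :=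
  {| Ob := PTree; Hom := EmbHom; idm := emb_id; comp := emb_comp;
     comp_assoc := emb_comp_assoc; comp_idl := emb_comp_idl; comp_idr := emb_comp_idr |}.

(** * The functor from embeddings to substitutions *)

Lemma val_pmap_insub (s : seq rawtree) : all tree_wf s ->
  map val (pmap insub s : seq PTree) = s.
Proof. by elim: s => //= t s IH /andP[wft /IH ss]; rewrite insubT /= ss. Qed.

Lemma all_ftrees (p q : PTree) (f : EmbHom p q) :
  all tree_wf (ftrees (val p) (val q) (emb_fun f)).
Proof.
apply/allP => _ /mapP[l + ->]; rewrite mem_iota => ltl.
exact: (fib_tree_wf (valP q) (emb_embedding f) ltl).
Qed.

Lemma subst_subproof (p q : PTree) (f : EmbHom p q) :
  is_subst (val p) (val q)
    (map val (pmap insub (ftrees (val p) (val q) (emb_fun f)) : seq PTree))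
    (fibs (val p) (val q) (emb_fun f)).
Proof.
rewrite val_pmap_insub ?all_ftrees //.
exact: embedding_subst (valP p) (valP q) (emb_embedding f).
Qed.

Definition subst_hom (p q : PTree) (f : EmbHom p q) : nupHom p q :=
  exist (fun m : seq PTree * seq (seq nat) => is_subst (val p) (val q) (map val m.1) m.2)
    (pmap insub (ftrees (val p) (val q) (emb_fun f)), fibs (val p) (val q) (emb_fun f))
    (subst_subproof f).

Lemma mtrees_subst_hom (p q : PTree) (f : EmbHom p q) :
  mtrees (subst_hom f) = ftrees (val p) (val q) (emb_fun f).
Proof. by rewrite /mtrees val_pmap_insub ?all_ftrees. Qed.

Lemma mshuf_subst_hom (p q : PTree) (f : EmbHom p q) :
  mshuf (subst_hom f) = fibs (val p) (val q) (emb_fun f).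
Proof. by []. Qed.

Lemma subst_hom_id (p : PTree) : nup_is_id (subst_hom (emb_id p)).
Proof.
have wfp := valP p; rewrite /nup_is_id mtrees_subst_hom mshuf_subst_hom.
have fibE l : l < nv (val p) -> fib (val p) (val p) (emb_fun (emb_id p)) l = [:: l].
  move=> ltl; rewrite (@fib_ext _ _ _ id) // => [|v ltv]; last by rewrite /emb_fun /= nth_iota.
  apply: (irr_sorted_eq ltn_trans ltnn (fib_sorted _ _ _ _)) => // w.
  rewrite mem_fib inE; apply/andP/eqP => [[ltw /infibP[_ pre H]]|->].
    apply: (addr_inj wfp ltw ltl); apply: prefix_anti => //.
    by apply: H => //; exact: prefix_refl.
  by split=> //; apply/infibP; split=> //; exact: prefix_refl.
split; apply/eq_in_map => l; rewrite mem_iota => ltl; rewrite fibE //.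
rewrite /sub /corolla /=; congr (_, [:: _]).
case pl : (par _ l) => [[j k]|//]; rewrite inE.
by case: eqP => // jl; case: (par_neq wfp pl).
Qed.

Lemma subst_hom_comp (p q r : PTree) (g : EmbHom q r) (f : EmbHom p q) :
  nup_is_comp (subst_hom g) (subst_hom f) (subst_hom (emb_comp g f)).
Proof.
have [wfp wfq wfr] := And3 (valP p) (valP q) (valP r).
have [Ef Eg Egf] := And3 (emb_embedding f) (emb_embedding g) (emb_embedding (emb_comp g f)).
move=> l ltl; rewrite !mtrees_subst_hom !mshuf_subst_hom !nth_ftrees // !nth_fibs //.
rewrite -(fib_ext _ (nth_comp _ f)) //.
set S := fib _ _ (emb_fun f) l; set T := fib _ _ (_ \o _) l.
(* The required vertex bijection consists of the fibres of the restriction of [g]. *)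
exists (fibs (sub (val q) S) (sub (val r) T)
  (fiber_map (val p) (val q) (val r) (emb_fun f) (emb_fun g) l)); split.
  have -> : [seq nth (corolla 0) (ftrees (val q) (val r) (emb_fun g)) (nth 0 S u)
      | u <- iota 0 (nv (sub (val q) S))] =
    ftrees (sub (val q) S) (sub (val r) T)
      (fiber_map (val p) (val q) (val r) (emb_fun f) (emb_fun g) l).
    rewrite (fiber_ftrees wfp wfq wfr Ef Eg ltl).
    apply/eq_in_map => u; rewrite mem_iota /= add0n nv_sub => ltu.
    by rewrite nth_ftrees //; case: (S_infib ltu).
  apply: embedding_subst.
  - exact: (fib_tree_wf wfq Ef ltl).
  - exact: (fib_tree_wf wfr (embedding_comp Ef Eg) ltl).
  - exact: fiber_embedding.
move=> u x; rewrite nv_sub => ltu; have [ltw _] := S_infib ltu.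
rewrite nth_ftrees // nv_sub nth_fibs //; last by rewrite nv_sub.
rewrite nth_fibs // -(fiber_fib wfp wfq wfr Ef Eg ltl ltu) size_map => ltx.
by rewrite (nth_map 0).
Qed.

Definition subst_functor : Functor EmbCat C_nupOp_op :=
  @Build_Functor EmbCat C_nupOp_op id subst_hom subst_hom_id subst_hom_comp.

Lemma subst_hom_full (p q : PTree) (h : nupHom p q) : exists f : EmbHom p q, subst_hom f = h.
Proof.
have [wfp wfq] := conj (valP p) (valP q).
have Hs := valP h; set qs := map val (val h).1 in Hs.
have wfqs : all tree_wf qs by apply/allP => _ /mapP[t _ ->]; exact: valP.
have E := subst_embedding wfp wfq wfqs Hs.
have [qsE sgE] := subst_eq_fibs wfp wfq wfqs Hs.
set rho := subst_root qs (val h).2 in E qsE sgE.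
have semb : is_emb (val p) (val q) (mkseq rho (nv (val p))).
  apply/is_embP; rewrite size_mkseq; split=> //.
  by apply: embedding_ext E => // v ltv; rewrite nth_mkseq.
pose f : EmbHom p q := exist (fun s => is_emb _ _ s) _ semb; exists f.
have fE : {in gtn (nv (val p)), emb_fun f =1 rho} by move=> v ltv; rewrite /emb_fun /= nth_mkseq.
apply: val_inj; rewrite [val h]surjective_pairing; congr pair.
  apply: (inj_map val_inj); rewrite -/qs qsE val_pmap_insub ?all_ftrees //.
  by apply/eq_in_map => l; rewrite mem_iota => ltl; rewrite (fib_ext _ fE).
by rewrite sgE; apply/eq_in_map => l; rewrite mem_iota => ltl; rewrite (fib_ext _ fE).
Qed.

Lemma subst_ess_surjective : ess_surjective subst_functor.
Proof.
move=> d; exists d, (subst_hom (emb_id d)), (subst_hom (emb_id d)).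
have idid := subst_hom_comp (emb_id d) (emb_id d); rewrite emb_comp_idl in idid.
by split; exists (subst_hom (emb_id d)); split=> //; exact: subst_hom_id.
Qed.

(** By fullness, [d] with its identity is a sufficient family: every morphism out of [d] comes from
    an embedding. *)
Lemma subst_property_F : property_F subst_functor.
Proof.
move=> d; exists 1, (fun=> d), (fun=> subst_hom (emb_id d)) => c h.
have [f <-] := subst_hom_full h; exists ord0, f.
by have := subst_hom_comp f (emb_id d); rewrite emb_comp_idr.
Qed.

(** * The Groebner property *)

(** Embeddings respect the order of addresses but not vertex numbers. [rank] turns that order into
    numbers, so that [lexle] can also compare lists of image vertices. *)
Definition rank (t : rawtree) (v : nat) : nat :=
  count (fun w => lexle (addr t w) (addr t v)) (iota 0 (nv t)).

Lemma rank_lt t v w : v < nv t -> w < nv t ->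
  (rank t v < rank t w) = ~~ lexle (addr t w) (addr t v).
Proof.
move=> ltv ltw; case: (boolP (lexle (addr t w) (addr t v))) => [wv|nwv].
  apply/negbTE; rewrite -leqNgt; apply: sub_count => u /= uw; exact: lexle_trans uw wv.
apply: (@count_strict _ _ _ w) => //; rewrite ?mem_iota ?lexle_refl // => u /= uv.
by apply: lexle_trans uv _; case/orP: (lexle_total (addr t v) (addr t w)) => // /(negP nwv).
Qed.

Lemma rank_embedding q r g v w : embedding q r g -> v < nv q -> w < nv q ->
  (rank r (g v) < rank r (g w)) = (rank q v < rank q w).
Proof.
move=> Eg ltv ltw; rewrite !rank_lt ?(emb_lt Eg) // !lexleE.
by have := emb_prefix Eg (x := inl w) (y := inl v) ltw ltv;
  have := emb_dvg Eg (x := inl w) (y := inl v) ltw ltv => /= -> ->.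
Qed.

Lemma rank_inj t : tree_wf t -> {in gtn (nv t) &, injective (rank t)}.
Proof.
move=> wf v w ltv ltw eqr; apply: (addr_inj wf ltv ltw); apply: lexle_anti.
have := rank_lt ltv ltw; have := rank_lt ltw ltv.
by rewrite eqr ltnn => /esym/negbFE-> /esym/negbFE->.
Qed.

Lemma lexle_map_mono (D : pred nat) (h h' : nat -> nat) (s t : seq nat) :
  {in D &, forall x y, (h x < h y) = (h' x < h' y)} -> all D s -> all D t ->
  lexle (map h s) (map h t) = lexle (map h' s) (map h' t).
Proof.
move=> hh'; elim: s t => [|x s IH] [|y t] //= /andP[Dx Ds] /andP[Dy Dt].
have hE : (h x == h y) = (h' x == h' y).
  have := hh' x y Dx Dy; have := hh' y x Dy Dx.
  by case: (ltngtP (h x) (h y)); case: (ltngtP (h' x) (h' y)).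
by rewrite hh' // hE IH.
Qed.

(** The fixed length matters: [[:: 1]], [[:: 0; 1]], [[:: 0; 0; 1]] and so on descend for ever. *)
Lemma lexle_least n (P : seq nat -> Prop) :
  (exists s, P s) -> (forall s, P s -> size s = n) ->
  exists m, P m /\ forall s, P s -> lexle m s.
Proof.
elim: n P => [|n IH] P [s Ps] szP.
  by exists s; split=> // t _; rewrite (size0nil (szP _ Ps)).
have [|a [[t Pat] amin]] := @nat_least (fun a => exists t, P (a :: t)).
  by case: s Ps (szP _ Ps) => // a t Pat _; exists a, t.
have [||m [Pm mmin]] := IH (fun t => P (a :: t)); first by exists t.
  by move=> u /szP[].
exists (a :: m); split=> // -[/szP //|b u] Pbu /=.
have := amin b (ex_intro _ u Pbu); rewrite leq_eqVlt => /orP[/eqP ab|->//].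
by rewrite -ab eqxx mmin ?orbT // ab.
Qed.

Definition emb_le (c d : PTree) (f f' : EmbHom c d) : Prop :=
  lexle (map (rank (val d)) (val f)) (map (rank (val d)) (val f')).

Lemma emb_all (c d : PTree) (f : EmbHom c d) : all (gtn (nv (val d))) (val f).
Proof. by apply/allP => v; exact: emb_entries. Qed.

Lemma emb_le_anti (c d : PTree) (f f' : EmbHom c d) : emb_le f f' -> emb_le f' f -> f = f'.
Proof.
move=> le1 le2; apply: val_inj.
apply: (inj_in_map (rank_inj (valP d))); rewrite ?inE; try exact: emb_all.
by apply: lexle_anti; rewrite le1 le2.
Qed.

Lemma emb_le_comp (c d e : PTree) (f f' : EmbHom c d) (g : EmbHom d e) :
  emb_le (emb_comp g f) (emb_comp g f') <-> emb_le f f'.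
Proof.
rewrite /emb_le /= -!map_comp (@lexle_map_mono (gtn (nv (val d))) _ (rank (val d))) ?emb_all //.
by move=> x y ltx lty; exact: rank_embedding (emb_embedding g) ltx lty.
Qed.

Lemma emb_le_admissible (c : PTree) : @admissible_order EmbCat c (@emb_le c).
Proof.
split=> [d|d e f f' g [le ne]]; last first.
  split; first exact/emb_le_comp.
  move=> eqg; apply: ne; apply: emb_le_anti => //; apply/(emb_le_comp _ _ g).
  by have := eqg; rewrite /= => ->; exact: lexle_refl.
split.
- by move=> f; exact: lexle_refl.
- exact: emb_le_anti.
- by move=> f f' f''; exact: lexle_trans.
- by move=> f f'; apply/orP; exact: lexle_total.
move=> P [f Pf].
have [||m [[h [Ph <-]] hmin]] := @lexle_least (nv (val c))
    (fun s => exists h, P h /\ map (rank (val d)) (val h) = s).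
- by exists (map (rank (val d)) (val f)), f.
- by move=> _ [h [_ <-]]; rewrite size_map; exact: emb_size.
by exists h; split=> // h' Ph'; apply: hmin; exists h'.
Qed.

(** * Noetherianity from Kruskal's theorem *)

Section Noetherian.
Variables (c : PTree) (s : nat -> {d : PTree & EmbHom c d}).

Let p := val c.
Let T n : rawtree := val (projT1 (s n)).
Let f n : seq nat := val (projT2 (s n)).

Lemma T_wf n : tree_wf (T n).
Proof. exact: (valP (projT1 (s n))). Qed.

Lemma f_embedding n : embedding p (T n) (nth 0 (f n)).
Proof. exact: emb_embedding. Qed.

Lemma f_size n : size (f n) = nv p.
Proof. exact: emb_size. Qed.

Lemma f_uniq n : uniq (f n).
Proof.
apply/(uniqP 0) => i j; rewrite !inE f_size => lti ltj eqf.
have := @target_inj p (T n) (nth 0 (f n)) (valP c) (f_embedding n) (inl i) (inl j) lti ltj.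
by rewrite /= eqf => /(_ erefl)[].
Qed.

(** The pair [(n, x)] stands for the subtree of [T n] at [x], so that subtrees of all the [T n] form
    one type. *)
Definition pointed := (nat * node)%type.

Definition pvalid (X : pointed) : Prop := node_valid (T X.1) X.2.

(* Labelling a node of [T n] by its preimage under [f n] forces a label-preserving map
   from [T i] to [T j] to commute with [f i] and [f j]. *)
Definition label (X : pointed) : nat :=
  match X.2 with inl v => index v (f X.1) | inr k => nv p + k end.

Definition children (X : pointed) : seq pointed :=
  match X.2 with
  | inl v => [seq (X.1, node_at (T X.1) (v, k)) | k <- iota 1 (ar (T X.1) v)]
  | inr _ => [::]
  end.

Definition weight (X : pointed) : nat :=
  count (fun y => prefix (node_addr (T X.1) X.2) (node_addr (T X.1) y)) (nodes (T X.1)).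

Definition below (X : pointed) (a : seq nat) (y : node) : Prop :=
  node_valid (T X.1) y /\ node_addr (T X.1) y = node_addr (T X.1) X.2 ++ a.

(* [e] acts on addresses relative to the base points. *)
Definition pembed (X Y : pointed) : Prop := exists e : seq nat -> seq nat,
  [/\ forall a y, below X a y ->
        exists y', below Y (e a) y' /\ label (Y.1, y') = label (X.1, y),
      forall a b y z, below X a y -> below X b z -> a <> b -> prefix a b ->
        prefix (e a) (e b) /\ e a <> e b
    & forall a b y z, below X a y -> below X b z -> dvg a b -> dvg (e a) (e b)].

Lemma pembed_trans X Y Z : pembed X Y -> pembed Y Z -> pembed X Z.
Proof.
move=> [e [eb ep ed]] [e' [eb' ep' ed']]; exists (e' \o e); split.
- move=> a y /eb[y' [/eb'[z [bz lz]] ly]]; exists z; split=> //; by rewrite lz.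
- move=> a b y z bx bz ne pre; have [y' [by' _]] := eb _ _ bx; have [z' [bz' _]] := eb _ _ bz.
  by have [pre' ne'] := ep _ _ _ _ bx bz ne pre; exact: ep' by' bz' ne' pre'.
- move=> a b y z bx bz d; have [y' [by' _]] := eb _ _ bx; have [z' [bz' _]] := eb _ _ bz.
  exact: ed' by' bz' (ed _ _ _ _ bx bz d).
Qed.

(** Vertices outside the image share the label [nv p], the length of [f n], and leaves come after
    it. The bound is independent of [n] because [T n] has as many leaves as [p]. *)
Lemma label_lt X : pvalid X -> label X < nv p + nleaves p.
Proof.
case: X => n [v|k]; rewrite /pvalid /label /=.
  move=> _; have := index_size v (f n); rewrite (f_size n) => le.
  by apply: leq_ltn_trans le _; rewrite nleavesE addnS ltnS leq_addr.
by rewrite -(emb_nleaves (f_embedding n)) ltn_add2l => /andP[].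
Qed.

(** List positions start at 0 but outgoing half-edges at 1, whence [i.+1]. *)
Variant child_spec (X : pointed) (i : nat) : pointed -> Prop :=
  ChildSpec v of X.2 = inl v & slot (T X.1) (v, i.+1)
    : child_spec X i (X.1, node_at (T X.1) (v, i.+1)).

Lemma childP X i : pvalid X -> i < size (children X) ->
  child_spec X i (nth (0, inl 0) (children X) i).
Proof.
case: X => n [v|k] //; rewrite /pvalid /children /= size_map size_iota => vx lti.
rewrite (nth_map 0); last by rewrite size_iota.
rewrite nth_iota; last by [].
by apply: (@ChildSpec (n, inl v) i v); rewrite // /slot /= vx.
Qed.

Lemma child_valid X i : pvalid X -> i < size (children X) ->
  pvalid (nth (0, inl 0) (children X) i).
Proof.
by move=> vX lti; case: (childP vX lti) => v _ sl; exact: (node_at_valid (T_wf _) sl).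
Qed.

Lemma child_addr X i a y : pvalid X -> i < size (children X) ->
  below (nth (0, inl 0) (children X) i) a y <-> below X (i.+1 :: a) y.
Proof.
move=> vX lti; case: (childP vX lti) => v vE sl.
by rewrite /below /= vE (node_at_addr (T_wf _) sl) /haddr /= cat_rcons.
Qed.

Lemma child_fst X i : pvalid X -> i < size (children X) ->
  (nth (0, inl 0) (children X) i).1 = X.1.
Proof. by move=> vX lti; case: (childP vX lti). Qed.

Lemma below_child X k a y : pvalid X -> below X (k :: a) y -> 0 < k /\ k.-1 < size (children X).
Proof.
case: X => n [v|i] vX [vy ya]; rewrite /= -cat_rcons in ya; last first.
  have /(leaf_node_maximal (T_wf n) vX vy) yE : prefix (node_addr (T n) (inr i)) (node_addr (T n) y).
    by rewrite ya /= -cats1 -catA prefix_prefix.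
  by move/(congr1 size): ya; rewrite yE /= size_cat size_rcons addSn => /eqP; rewrite ltn_eqF // ltnS leq_addr.
have : slot (T n) (v, k).
  by apply: (prefix_slot (T_wf n) vX vy); rewrite ya prefix_prefix.
case/andP=> /= _ /andP[k0 lek]; split=> //.
by rewrite /children /= size_map size_iota prednK.
Qed.

Lemma child_weight X i : pvalid X -> i < size (children X) ->
  weight (nth (0, inl 0) (children X) i) < weight X.
Proof.
move=> vX lti; have bel a y := @child_addr X i a y vX lti.
have [fE vc] := (child_fst vX lti, child_valid vX lti).
have [_ cE] : below X [:: i.+1] (nth (0, inl 0) (children X) i).2.
  by apply/bel; rewrite /below cats0.
rewrite /weight fE; apply: (@count_strict _ _ _ X.2).
- by move=> y /=; apply: prefix_trans; rewrite cE prefix_prefix.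
- by rewrite mem_nodes.
- exact: prefix_refl.
- by apply/negP => /size_prefix; rewrite cE size_cat addn1 ltnn.
Qed.

Lemma pembed_child X Y i : pvalid Y -> i < size (children Y) ->
  pembed X (nth (0, inl 0) (children Y) i) -> pembed X Y.
Proof.
move=> vY lti [e [eb ep ed]]; exists (fun a => i.+1 :: e a); split.
- move=> a y /eb[y' [/(child_addr _ _ vY lti) by' ly]]; exists y'; split=> //.
  by rewrite -ly child_fst.
- move=> a b y z bx bz ne pre; have [pre' ne'] := ep _ _ _ _ bx bz ne pre.
  by rewrite /= eqxx; split=> // -[].
- by move=> a b y z bx bz d; rewrite /= eqxx ltnn (ed _ _ _ _ bx bz d).
Qed.

(** The first digit is moved by [g], up to the shift between positions and half-edges, and the rest
    by the embedding of that child. Monotonicity of [g] keeps distinct children in order; [lXY]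
    takes care of the base points. *)
Lemma pembed_node X Y : pvalid X -> pvalid Y -> label X = label Y ->
  list_emb pembed (0, inl 0) (children X) (children Y) -> pembed X Y.
Proof.
move=> vX vY lXY [g [gm gs gR]].
have /choice_fun[e eP] : forall i, exists e : seq nat -> seq nat, i < size (children X) ->
  [/\ forall a y, below X (i.+1 :: a) y ->
        exists y', below Y ((g i).+1 :: e a) y' /\ label (Y.1, y') = label (X.1, y),
      forall a b y z, below X (i.+1 :: a) y -> below X (i.+1 :: b) z -> a <> b -> prefix a b ->
        prefix (e a) (e b) /\ e a <> e b
    & forall a b y z, below X (i.+1 :: a) y -> below X (i.+1 :: b) z -> dvg a b -> dvg (e a) (e b)].
  move=> i; case: (ltnP i (size (children X))) => [lti|_]; last by exists id.
  have [e [eb ep ed]] := gR _ lti; exists e => _.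
  have bel a y := @child_addr X i a y vX lti; split.
  - move=> a y /bel/eb[y' [/(child_addr _ _ vY (gs _ lti)) by' ly]]; exists y'; split=> //.
    by rewrite (child_fst vX lti) (child_fst vY (gs _ lti)) in ly.
  - by move=> a b y z /bel bx /bel bz; exact: ep bx bz.
  - by move=> a b y z /bel bx /bel bz; exact: ed bx bz.
exists (fun a => if a is k :: b then (g k.-1).+1 :: e k.-1 b else [::]); split.
- move=> [|k a] y bx.
    exists Y.2; split; first by rewrite /below cats0.
    case: bx => vy; rewrite cats0 => /(node_addr_inj (T_wf _) vy vX) ->.
    by case: X Y lXY {vX vY gm gs gR eP vy} => [n x] [n' y'].
  have [k0 ltk] := below_child vX bx; case: k k0 ltk bx => // k _ ltk bx.
  by case: (eP k ltk) => eb _ _; exact: eb.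
- move=> [|k a] [|l b] y z bx bz //= ne /andP[/eqP kl pre]; subst l.
  have [k0 ltk] := below_child vX bx; case: k k0 ltk bx bz ne => // k _ ltk bx bz ne.
  case: (eP k ltk) => _ ep _; have [|pre' ne'] := ep _ _ _ _ bx bz _ pre.
    by move=> ab; apply: ne; rewrite ab.
  by rewrite eqxx; split=> // -[].
- move=> [|k a] [|l b] y z bx bz //=.
  have [k0 ltk] := below_child vX bx; have [l0 ltl] := below_child vX bz.
  case: k k0 ltk bx => // k _ ltk bx; case: l l0 ltl bz => // l _ ltl bz.
  case/orP=> [ltkl|/andP[/eqP[kl] d]]; first by rewrite ltnS gm.
  subst l; case: (eP k ltk) => _ _ ed; by rewrite eqxx (ed _ _ _ _ bx bz d) orbT.
Qed.

Lemma pembed_wqo : wqo_on pembed pvalid.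
Proof.
apply: (kruskal (x0 := (0, inl 0)) (lab := label) (K := nv p + nleaves p)
  (ch := children) (m := weight)).
- exact: pembed_trans.
- exact: label_lt.
- exact: child_valid.
- exact: child_weight.
- by move=> X Y i; exact: pembed_child.
- exact: pembed_node.
Qed.

(** Vertex labels are at most [nv p], so a leaf sharing one would have index 0, which no valid node
    has. *)
Lemma label_vertex n w v i : label (n, inr w) = label (i, inl v) -> w = 0.
Proof.
rewrite /label /= => E; have := index_size v (f i); rewrite -E (f_size i) -{2}[nv p]addn0 leq_add2l.
by rewrite leqn0 => /eqP.
Qed.

(** Between roots, relative addresses are absolute. Equal leaf labels then keep leaf indices, and
    equal vertex labels make [h] carry [f i] to [f j]. *)
Lemma pembed_factor i j :
  pembed (i, inl (root (T i))) (j, inl (root (T j))) ->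
  exists h : EmbHom (projT1 (s i)) (projT1 (s j)), projT2 (s j) = emb_comp h (projT2 (s i)).
Proof.
have [wfi wfj] := (T_wf i, T_wf j); case=> e [eb ep ed].
have bel y : node_valid (T i) y -> below (i, inl (root (T i))) (node_addr (T i) y) y.
  by move=> vy; split=> //=; rewrite addr_root.
have /choice_fun[h hP] : forall v, exists w, v < nv (T i) ->
    [/\ w < nv (T j), addr (T j) w = e (addr (T i) v) & index w (f j) = index v (f i)].
  move=> v; case: (ltnP v (nv (T i))) => [ltv|_]; last by exists 0.
  have [[w|k] [[/= vy ey] ly]] := eb _ _ (bel (inl v) ltv).
    by exists w => _; rewrite ey addr_root.
  by move: vy; rewrite (label_vertex ly).
have hx x : node_valid (T i) x -> node_addr (T j) (target h x) = e (node_addr (T i) x).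
  case: x => [v|k] vx /=; first by case: (hP v vx).
  have [[w|k'] [[/= vy ey] ly]] := eb _ _ (bel (inr k) vx).
    by move: vx; rewrite /= (label_vertex (esym ly)).
  by rewrite addr_root // in ey; move: ly; rewrite /label /= => /addnI kE; rewrite kE in ey.
(* The entries of [f i] are distinct, so [nth 0 (f i) l] has label [l]; its image has the same label
   and is therefore entry [l] of [f j]. *)
have hf l : l < nv p -> h (nth 0 (f i) l) = nth 0 (f j) l.
  move=> ltl; have [_ _] := hP _ (emb_lt (f_embedding i) ltl).
  rewrite index_uniq ?f_size ?f_uniq // => idx.
  by rewrite -{2}idx nth_index // -index_mem idx f_size.
have Eh : embedding (T i) (T j) h.
  apply: (embedding_intro wfi).
  - by move=> v /hP[].
  (* A pointed embedding may move its base point down; the label of the root prevents it here. *)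
  - have ltr : root p < nv p by exact: root_lt (valP c).
    by rewrite -(emb_root (f_embedding i)) -(emb_root (f_embedding j)) hf.
  - by rewrite -(emb_nleaves (f_embedding i)) -(emb_nleaves (f_embedding j)).
  - move=> x y vx vy ne; rewrite !hx // => pre; apply: (ep _ _ x y) => //; try exact: bel.
    by move=> eqa; apply: ne; exact: node_addr_inj eqa.
  - by move=> x y vx vy; rewrite !hx //; apply: (ed _ _ x y); exact: bel.
have hemb : is_emb (T i) (T j) (mkseq h (nv (T i))).
  apply/is_embP; rewrite size_mkseq; split=> //.
  by apply: embedding_ext Eh => // v ltv; rewrite nth_mkseq.
exists (exist (fun t => is_emb (T i) (T j) t) _ hemb); apply: val_inj => /=.
apply: (@eq_from_nth _ 0) => [|l]; rewrite ?size_map ?f_size // => ltl.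
have ltf := emb_lt (f_embedding i) ltl.
by rewrite (nth_map 0) ?f_size // /emb_fun /= nth_mkseq // hf.
Qed.
End Noetherian.

Lemma EmbCat_Groebner : Groebner EmbCat.
Proof.
move=> c; split; first by exists (@emb_le c); exact: emb_le_admissible.
move=> s; apply: NNPP => none.
apply: (@pembed_wqo c s (fun n => (n, inl (root (val (projT1 (s n))))))) => [n|i j lt_ij emb].
  exact: root_lt (valP _).
by apply: none; exists i, j; split=> //; exact: pembed_factor.
Qed.

Theorem theorem3p8 : quasi_Groebner C_nupOp_op.
Proof.
exists EmbCat, subst_functor; split.
- exact: EmbCat_Groebner.
- exact: subst_ess_surjective.
- exact: subst_property_F.
Qed.
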